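(* For each $n$, let $U_1, U_2, \ldots, U_n$ be independent random points, each uniformly distributed on $[0,1]^2$. Then, for any fixed integer $s \geq 0$, $$\lim_{n \rightarrow \infty} \frac{\mathbb{E}[Z_{=s}(\{U_1, U_2, \ldots, U_n\})]}{n^2} = 2.$$ Consequently, $$\lim_{n \rightarrow \infty} \frac{\mathbb{E}[Z_{\leq s}(\{U_1, U_2, \ldots, U_n\})]}{n^2} = 2(s+1).$$
   Context: For an integer $s \geq 0$ and a finite set $A \subset \mathbb{R}^2$, $Z_{=s}(A)$ denotes the number of triangles with vertices in $A$ that contain exactly $s$ points of $A$ in their interior, and $Z_{\leq s}(A) = \sum_{r=0}^{s} Z_{=r}(A)$ is the number of triangles with vertices in $A$ that contain at most $s$ points of $A$ in their interior. *)

(* Defs.v *)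
From HB Require Import structures.
From mathcomp Require Import all_boot all_order all_algebra finmap.
From mathcomp Require Import all_classical all_reals all_analysis.

Set Implicit Arguments.
Unset Strict Implicit.
Unset Printing Implicit Defensive.

Import Order.TTheory GRing.Theory Num.Theory.
Import numFieldNormedType.Exports.

Local Open Scope classical_set_scope.
Local Open Scope ring_scope.

(* The point type is [R * R] everywhere; [R^o * R^o] is the same type, written
   so that the library finds the structure of an [R]-vector space on it. *)
Definition convex_hull (R : realType) (A : set (R * R)) : set (R * R) :=
  smallest (@convex_set R (R^o * R^o)%type) A.

Definition collinear (R : realType) (A : set (R * R)) : Prop :=
  exists a b c : R, (a, b) <> (0, 0) /\
    forall p, A p -> a * p.1 + b * p.2 = c.

Definition triangles (R : realType) (A : {fset R * R}) : {fset {fset R * R}} :=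
  [fset t in fpowerset A | (#|` t| == 3%N) && ~~ `[< collinear [set` t] >]]%fset.

Definition interior_points (R : realType) (A t : {fset R * R}) : {fset R * R} :=
  [fset p in A | `[< (convex_hull [set` t])° p >]]%fset.

Definition Z_eq (R : realType) (s : nat) (A : {fset R * R}) : nat :=
  #|` [fset t in triangles A | #|` interior_points A t| == s]%fset|.

Definition Z_le (R : realType) (s : nat) (A : {fset R * R}) : nat :=
  (\sum_(r < s.+1) Z_eq r A)%N.

Definition unit_square (R : realType) : set (R * R) := `[0, 1] `*` `[0, 1].

(* The square has area 1, so its Lebesgue measure needs no normalization. *)
Definition uniform_on_square (d : measure_display) (T : measurableType d)
    (R : realType) (P : probability T R) (X : {RV P >-> (R * R)%type}) : Prop :=
  forall B : set (R * R), measurable B ->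
    distribution P X B =
    (lebesgue_measure \x lebesgue_measure)%E (B `&` @unit_square R).

Definition mutually_independent (d d' : measure_display) (T : measurableType d)
    (T' : measurableType d') (R : realType) (P : probability T R)
    (I : finType) (X : I -> {RV P >-> T'}) : Prop :=
  forall (J : {set I}) (B : I -> set T'),
    (forall i, i \in J -> measurable (B i)) ->
    P (\bigcap_(i in [set` J]) X i @^-1` B i) =
    (\prod_(i in J) P (X i @^-1` B i))%E.

Definition point_set (R : realType) (T : Type) (I : finType)
    (X : I -> T -> R * R) (w : T) : {fset R * R} :=
  [fset X i w | i : I]%fset.

(* Main.v *)
Require Import Defs.
From HB Require Import structures.
From mathcomp Require Import all_boot all_order all_algebra finmap.
From mathcomp Require Import all_classical all_reals all_analysis.
From mathcomp Require Import measurable_realfun.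
From mathcomp Require Import ring lra zify.
Import Order.TTheory GRing.Theory Num.Theory.
Import numFieldNormedType.Exports.

Local Open Scope classical_set_scope.
Local Open Scope ring_scope.
Set SsrOldRewriteGoalsOrder.
Set Implicit Arguments.
Unset Strict Implicit.
Unset Printing Implicit Defensive.

(* Order the three vertices of a triangle by abscissa, and let q be the middle
   one. When the vertices p and r and the abscissa of q are fixed, the line pr
   meets the vertical line through q at a height h that always lies in [0, 1],
   and the area of the triangle is w |q.2 - h| with w = (r.1 - p.1) / 2. With m
   further points, exactly s of them are inside with conditional probability
   C(m, s) a^s (1 - a)^(m - s), where a is the area; integrating over q.2 and
   multiplying by m + 1 gives w^-1 (B(w h) + B(w (1 - h))), where B(t) is the
   probability that a binomial variable of parameters m + 1 and t exceeds s.
   As B <= 1 and B(t) -> 1 for 0 < t < 1, integrating over q.1 in (p.1, r.1)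
   gives a quantity at most 4 that tends to 4 whenever p.1 < r.1, an event of
   probability 1/2. Hence
   (m + 1) C(m, s) E[a^s (1 - a)^(m - s); p, q, r in increasing order] -> 2, and
   the expected number of triangles is this quantity with m = n - 3 times
   n (n - 1), because m + 1 = n - 2. *)

(** * Interior of a triangle *)

Section triangle_interior.
Context {R : realType}.
Implicit Types p q r z : R * R.

(** Ordering by abscissa makes the limit independent of the outer vertices: for fixed [p] and [r]
    the slope [w] of the area in [q.2] is the same for every [q.1], and the interval open to [q.1]
    has length [2 w]. The singular factor [w^-1] thus cancels after the second integration, so that
    a constant dominates although [w] can be arbitrarily small. Passing from the count to this
    integral meets two obstacles. [Z_eq] is defined by hulls and interiors of a finite set in which
    random points may coincide. It is replaced by a sum of indicators, one for each triple of
    indices and each candidate set [S] of indices of interior points; both agree off the null event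
    that two abscissae coincide or a point lies on the boundary of the square. And independence is a
    product formula for events, whereas the triangle to be avoided or hit is itself random:
    uniqueness of product measures extends the formula to the joint law of the vertices beside the
    other points, and Tonelli then freezes the vertices. *)

Definition cross p q r : R :=
  (q.1 - p.1) * (r.2 - p.2) - (q.2 - p.2) * (r.1 - p.1).

(** [cross p q r] is twice the signed area. Multiplying by it makes the three strict edge tests
    independent of the orientation, and false for a flat triangle. *)
Definition inside p q r z : bool :=
  [&& 0 < cross p q r * cross p q z, 0 < cross p q r * cross q r z
    & 0 < cross p q r * cross r p z].

Lemma convex_set_pair (A : set (R * R)) :
  @convex_set R (R^o * R^o)%type A <->
  forall p q (t : R), 0 <= t <= 1 -> A p -> A q ->
    A (t * p.1 + (1 - t) * q.1, t * p.2 + (1 - t) * q.2).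
Proof.
split=> [cA p q t /andP[t0 t1] Ap Aq|H p q t /set_mem Ap /set_mem Aq].
  have t01 : (0 <= t <= 1)%R by rewrite t0.
  have := cA p q (Itv01 t0 t1) (mem_set Ap) (mem_set Aq).
  by move/set_mem.
apply/mem_set.
have := H p q t%:num _ Ap Aq; apply.
by rewrite ge0 le1.
Qed.

Lemma hull_half_plane (a b c : R) (A : set (R * R)) :
  (forall p, A p -> 0 <= a * p.1 + b * p.2 + c) ->
  forall p, convex_hull A p -> 0 <= a * p.1 + b * p.2 + c.
Proof.
move=> H p; apply: (@smallest_sub _ _ A [set p | 0 <= a * p.1 + b * p.2 + c]) => //.
apply/convex_set_pair => {H} {}p q t /andP[t0 t1] /= Hp Hq.
have := mulr_ge0 t0 Hp; have : 0 <= (1 - t) * (a * q.1 + b * q.2 + c).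
  by rewrite mulr_ge0// subr_ge0.
nra.
Qed.

Lemma interior_half_plane (a b c : R) (A : set (R * R)) p :
  (a, b) != 0 -> (forall q, A q -> 0 <= a * q.1 + b * q.2 + c) ->
  A° p -> 0 < a * p.1 + b * p.2 + c.
Proof.
move=> ab0 H Ap.
have ab_gt0 : 0 < a * a + b * b.
  move: ab0; rewrite -pair_eqE /= negb_and => /orP[|] h; rewrite -?expr2.
    by rewrite ltr_pwDl ?sqr_ge0// exprn_even_gt0.
  by rewrite ltr_wpDl ?sqr_ge0// exprn_even_gt0.
(* Moving from [p] against the normal [(a, b)] stays in [A] for a while. *)
have cf : (fun t : R => (p.1 - t * a, p.2 - t * b)) @ 0 --> p.
  rewrite [X in _ --> X](_ : _ = (p.1 - 0 * a, p.2 - 0 * b)); last first.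
    by rewrite !mul0r !subr0; case: p {Ap}.
  apply: (@cvg_pair _ _ _ _ (nbhs (p.1 - 0 * a)) (nbhs (p.2 - 0 * b))) => /=;
   apply: cvgB; [exact: cvg_cst| |exact: cvg_cst|];
     apply: cvgM; [exact: cvg_id|exact: cvg_cst|exact: cvg_id|exact: cvg_cst].
have := cf _ Ap => /= /nbhs_ballP[e /= e0 He].
have /He /H /= : ball (0 : R) e (e / 2).
  by rewrite /ball/= sub0r normrN ger0_norm ?divr_ge0 ?ltW// ltr_pdivrMr// ltr_pMr// ltr1n.
have : 0 < e / 2 * (a * a + b * b) by rewrite mulr_gt0// divr_gt0.
set f := e / 2.
nra.
Qed.


Lemma open_half_plane (a b c : R) : open [set z : R * R | 0 < a * z.1 + b * z.2 + c].
Proof.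
rewrite (_ : mkset _ = (fun z => a * z.1 + b * z.2 + c) @^-1` [set x | 0 < x])//.
apply: open_comp; last exact: open_gt.
move=> z _; apply: cvgD; last exact: cvg_cst.
apply: cvgD; apply: cvgM; try exact: cvg_cst.
  exact: cvg_fst.
exact: cvg_snd.
Qed.

Lemma cross_affine p q z :
  cross p q z = - (q.2 - p.2) * z.1 + (q.1 - p.1) * z.2 +
                ((q.2 - p.2) * p.1 - (q.1 - p.1) * p.2).
Proof. by rewrite /cross; ring. Qed.

Lemma open_inside p q r : open [set z | inside p q r z].
Proof.
have cc c a b : open [set z : R * R | 0 < c * cross a b z].
  rewrite (_ : mkset _ = [set z | 0 < (c * - (b.2 - a.2)) * z.1 +
     (c * (b.1 - a.1)) * z.2 + c * ((b.2 - a.2) * a.1 - (b.1 - a.1) * a.2)]).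
    exact: open_half_plane.
  by apply/funext => z; rewrite /mkset cross_affine; congr (is_true (0 < _)); ring.
rewrite (_ : mkset _ = [set z | 0 < cross p q r * cross p q z] `&`
   [set z | 0 < cross p q r * cross q r z] `&`
   [set z | 0 < cross p q r * cross r p z]).
  exact: (openI (openI (cc _ _ _) (cc _ _ _)) (cc _ _ _)).
by apply/seteqP; split=> z /= => [/and3P[]|[[h1 h2 h3]]] //; apply/and3P.
Qed.

(** Each oriented edge form is nonnegative at the three vertices, hence on the hull, hence positive
    in its interior. Conversely [inside] defines an open set, so its inclusion in the hull is
    enough, and barycentric coordinates give it. *)
Lemma interior_hull_triangle p q r z : cross p q r != 0 ->
  (convex_hull [set p; q; r])° z <-> inside p q r z.
Proof.
move=> D0; set D := cross p q r in D0 *; split=> [Hz|].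
  have main a b c : cross a b c = D -> [set p; q; r] = [set a; b; c] -> 0 < D * cross a b z.
    move=> abc E.
    have -> : D * cross a b z = (D * - (b.2 - a.2)) * z.1 +
     (D * (b.1 - a.1)) * z.2 + D * ((b.2 - a.2) * a.1 - (b.1 - a.1) * a.2).
      by rewrite cross_affine; ring.
    apply: (interior_half_plane _ _ Hz).
      apply: contraNneq D0 => -[] /eqP; rewrite mulf_eq0 => /orP[/eqP->//|/eqP e1].
      move=> /eqP; rewrite mulf_eq0 => /orP[/eqP->//|/eqP e2].
      rewrite -abc /cross.
      have -> : b.1 = a.1 by lra.
      have -> : b.2 = a.2 by lra.
      by rewrite !subrr !mul0r subrr.
    apply: hull_half_plane; rewrite E => y.
    have -> : D * - (b.2 - a.2) * y.1 +
     (D * (b.1 - a.1)) * y.2 + D * ((b.2 - a.2) * a.1 - (b.1 - a.1) * a.2) = D * cross a b y.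
      by rewrite cross_affine; ring.
    case=> [[]|] ->.
    - by rewrite [cross _ _ _](_ : _ = 0) ?mulr0// /cross; ring.
    - by rewrite [cross _ _ _](_ : _ = 0) ?mulr0// /cross; ring.
    - by rewrite abc -expr2 sqr_ge0.
  apply/and3P; split.
  - exact: (main p q r).
  - apply: (main q r p); first by rewrite /D /cross; ring.
    by apply/seteqP; split=> y /=; tauto.
  - apply: (main r p q); first by rewrite /D /cross; ring.
    by apply/seteqP; split=> y /=; tauto.
move=> Hz; suff : [set z | inside p q r z] `<=` convex_hull [set p; q; r].
  by rewrite (open_subsetE _ (@open_inside p q r)); exact.
move=> {Hz}z /= /and3P[]; rewrite -/D => h1 h2 h3 C [/convex_set_pair cC sC].
have D20 : 0 < D * D by rewrite -expr2 exprn_even_gt0.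
have s : D * cross p q z + D * cross q r z + D * cross r p z = D * D.
  by rewrite /D /cross; ring.
(* Barycentric coordinates of [z] with respect to [p], [q], [r], scaled by [D * D]. Convexity
   handles two points at a time: [p] and [q] are combined first, then the result with [r]. *)
pose al := D * cross q r z; pose be := D * cross r p z; pose ga := D * cross p q z.
have ab0 : 0 < al + be by rewrite addr_gt0.
have t1 : 0 <= al / (al + be) <= 1.
  apply/andP; split; first by apply: divr_ge0; exact: ltW.
  by rewrite ler_pdivrMr// mul1r lerDl ltW.
have t2 : 0 <= (al + be) / (D * D) <= 1.
  apply/andP; split; first by apply: divr_ge0; exact: ltW.
  by rewrite ler_pdivrMr// mul1r -s; move: h1; rewrite -/al -/be -/ga; lra.
have := cC _ r _ t2 (cC p q _ t1 (sC _ (or_introl (or_introl erefl)))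
  (sC _ (or_introl (or_intror erefl)))) (sC _ (or_intror erefl)).
have e : D * D = al + be + ga by rewrite -s /al /be /ga; ring.
rewrite e; congr (C _); rewrite [RHS]surjective_pairing.
have n1 : al + be != 0 by rewrite gt_eqF.
have n2 : al + be + ga != 0 by rewrite gt_eqF// addr_gt0.
congr pair => /=.
  apply: (mulfI n2).
  transitivity (al * p.1 + be * q.1 + ga * r.1); first by field; rewrite n1 n2.
  by rewrite /al /be /ga /D /cross; ring.
apply: (mulfI n2).
transitivity (al * p.2 + be * q.2 + ga * r.2); first by field; rewrite n1 n2.
by rewrite /al /be /ga /D /cross; ring.
Qed.

(** A normal [(a, b)] to a common line annihilates [q - p] and [r - p], so [a] and [b] times their
    determinant vanish, as in Cramer's rule. Conversely the line [pq] serves, with a normal that is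
    nonzero because the abscissae differ. *)
Lemma collinear_triangle p q r : p.1 != q.1 ->
  collinear [set p; q; r] <-> cross p q r = 0.
Proof.
move=> pq; split=> [[a [b [c [ab H]]]]|H].
  have hp := H p (or_introl (or_introl erefl)).
  have hq := H q (or_introl (or_intror erefl)).
  have hr := H r (or_intror erefl).
  have e1 : a * (q.1 - p.1) + b * (q.2 - p.2) = 0.
    by rewrite !mulrBr addrACA -opprD hp hq subrr.
  have e2 : a * (r.1 - p.1) + b * (r.2 - p.2) = 0.
    by rewrite !mulrBr addrACA -opprD hp hr subrr.
  have ea : a * cross p q r = 0.
    transitivity ((a * (q.1 - p.1) + b * (q.2 - p.2)) * (r.2 - p.2) -
                  (a * (r.1 - p.1) + b * (r.2 - p.2)) * (q.2 - p.2)).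
      by rewrite /cross; ring.
    by rewrite e1 e2 !mul0r subrr.
  have eb : b * cross p q r = 0.
    transitivity ((a * (r.1 - p.1) + b * (r.2 - p.2)) * (q.1 - p.1) -
                  (a * (q.1 - p.1) + b * (q.2 - p.2)) * (r.1 - p.1)).
      by rewrite /cross; ring.
    by rewrite e1 e2 !mul0r subrr.
  have [a0|a0] := eqVneq a 0; last by apply: (mulfI a0); rewrite ea mulr0.
  have b0 : b != 0 by apply/eqP => b0; apply: ab; rewrite a0 b0.
  by apply: (mulfI b0); rewrite eb mulr0.
exists (- (q.2 - p.2)), (q.1 - p.1), (- ((q.2 - p.2) * p.1 - (q.1 - p.1) * p.2)); split.
  by move=> [_ /eqP]; rewrite subr_eq0 eq_sym (negbTE pq).
move=> y h; apply/eqP; rewrite -subr_eq0 opprK -cross_affine; apply/eqP.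
case: h => [[]|] -> //; by rewrite /cross; ring.
Qed.
End triangle_interior.

(** * Triangles as ordered triples of indices *)

Section triangle_index.
Context {R : realType}.
Implicit Types p q r z : R * R.

Definition triangle_lr p q r : bool :=
  [&& p.1 < q.1, q.1 < r.1 & cross p q r != 0].

Lemma set_fset3 p q r : [set` [fset p; q; r]%fset] = [set p; q; r].
Proof.
apply/seteqP; split=> z /=; rewrite !inE.
  by move=> /orP[/orP[]|] /eqP ->; [left; left|left; right|right].
by move=> [[]|] ->; rewrite eqxx ?orbT.
Qed.

(** Allows the count of interior points to range over all indices, those of the vertices
    included. *)
Lemma inside_notin p q r l : l \in [:: p; q; r] -> inside p q r l = false.
Proof.
rewrite !inE => /or3P[] /eqP ->; apply/negP => /and3P[].
- by rewrite [cross p q p](_ : _ = 0) ?mulr0 ?ltxx// /cross; ring.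
- by rewrite [cross p q q](_ : _ = 0) ?mulr0 ?ltxx// /cross; ring.
- by move=> _; rewrite [cross q r r](_ : _ = 0) ?mulr0 ?ltxx// /cross; ring.
Qed.

(** A triple is stored as (left, right), middle: the outer vertices form the pair that is frozen
    while the middle one is integrated. *)
Definition triangle_index n (x : 'I_n -> R * R) s : {set 'I_n * 'I_n * 'I_n} :=
  [set t | triangle_lr (x t.1.1) (x t.2) (x t.1.2) &
     #|[set l | inside (x t.1.1) (x t.2) (x t.1.2) (x l)]| == s]%SET.

(** With distinct abscissae, the vertices of a triangle have exactly one increasing order, so
    triangles correspond bijectively to index triples; points and indices also correspond, so the
    interior counts agree. *)
Lemma Z_eq_triangle_index s n (x : 'I_n -> R * R) :
  injective (fun i => (x i).1) ->
  Z_eq s [fset x i | i : 'I_n]%fset = #|triangle_index x s|.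
Proof.
move=> x1inj.
have xinj : injective x by move=> i j e; apply: x1inj; rewrite e.
set A := [fset x i | i : 'I_n]%fset.
have memA i : x i \in A by apply/imfsetP; exists i.
pose F (t : 'I_n * 'I_n * 'I_n) := [fset x t.1.1; x t.2; x t.1.2]%fset.
have card_int p q r : cross p q r != 0 ->
    #|` interior_points A [fset p; q; r]%fset| = #|[set l | inside p q r (x l)]%SET|.
  move=> D0; rewrite /interior_points.
  rewrite (_ : [fset _ in _ | _]%fset = [fset x l | l in [set l | inside p q r (x l)]%SET]%fset).
    by rewrite card_imfset//= -cardE.
  apply/fsetP => z; apply/idP/imfsetP => /=.
    rewrite !inE /= => /andP[/imfsetP[i _ ->]] /asboolP.
    rewrite set_fset3 => /(interior_hull_triangle _ D0) h.
    by exists i => //; rewrite inE.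
  move=> [i]; rewrite inE => h ->; rewrite !inE memA/=.
  by apply/asboolP; rewrite set_fset3; apply/interior_hull_triangle.
have Finj : {in triangle_index x s &, injective F}.
  move=> [[i k] j] [[i' k'] j']; rewrite !inE /= => /andP[/and3P[ij jk _] _].
  move=> /andP[/and3P[ij' jk' _] _] /fsetP e.
  pose lt1 := relpre (fst : R * R -> R) <%O.
  have tr : transitive lt1 by move=> a b c; exact: lt_trans.
  have ir : irreflexive lt1 by move=> a; exact: ltxx.
  (* A list strictly sorted by abscissa is determined by its elements. *)
  have : [:: x i; x j; x k] = [:: x i'; x j'; x k'].
    apply: (irr_sorted_eq tr ir); rewrite /= ?andbT ?ij ?ij'//.
    by move=> z; have := e z; rewrite /F/= !inE !orbA.
  by case=> /xinj -> /xinj -> /xinj ->.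
rewrite /Z_eq (_ : [fset _ in _ | _]%fset = [fset F t | t in triangle_index x s]%fset).
  by rewrite card_in_imfset//= -cardE.
apply/fsetP => t; apply/idP/imfsetP => /=.
  rewrite !inE /= => /andP[/andP[]]; rewrite fpowersetE => /fsubsetP tA.
  move=> /andP[/eqP t3 /asboolP nc] ts.
  pose le1 := relpre (fst : R * R -> R) <=%O.
  have tr : transitive le1 by move=> a b c; exact: le_trans.
  have tot : total le1 by move=> a b; exact: le_total.
  have := sort_sorted tot t; have := size_sort le1 t.
  have := sort_uniq le1 t; rewrite fset_uniq.
  have := mem_sort le1 t.
  rewrite [size t]t3; case: (sort _ _) => [//|p [//|q [//|r [|//]]]].
  move=> mt /= /and3P[u1 u2 _] _ /and3P[pq qr _].
  have te : t = [fset p; q; r]%fset.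
    by apply/fsetP => z; rewrite !inE -mt !inE orbA.
  have ex z : z \in [:: p; q; r] -> exists i, z = x i.
    by rewrite mt => /tA /imfsetP[i _ ->]; exists i.
  have [i pi] := ex p (mem_head _ _).
  have [j qj] : exists j, q = x j by apply: ex; rewrite !inE eqxx orbT.
  have [k rk] : exists k, r = x k by apply: ex; rewrite !inE eqxx !orbT.
  (* Sorting yields weak inequalities only; strictness comes from the injectivity of the abscissa on
     distinct vertices. *)
  have lt1 : p.1 < q.1.
    rewrite lt_neqAle pq andbT; apply: contra u1 => /eqP.
    by rewrite pi qj => /x1inj ->; rewrite mem_head.
  have lt2 : q.1 < r.1.
    rewrite lt_neqAle qr andbT; apply: contra u2 => /eqP.
    by rewrite rk qj => /x1inj ->; rewrite mem_head.
  have D0 : cross p q r != 0.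
    apply/eqP => D0; apply: nc; rewrite te set_fset3; apply/collinear_triangle => //.
    by rewrite lt_eqF.
  exists (i, k, j) => /=; last by rewrite /F /= -pi -qj -rk.
  by rewrite inE /= -pi -qj -rk /triangle_lr lt1 lt2 D0 /= -card_int// -te.
move=> [[[i k] j]]; rewrite inE /= => /andP[/and3P[ij jk D0] si] ->.
rewrite /F /= !inE /= card_int// si andbT.
have ik : (x i).1 < (x k).1 by apply: lt_trans jk.
apply/and3P; split.
- by rewrite fpowersetE; apply/fsubsetP => z; rewrite !inE => /orP[/orP[]|] /eqP ->.
- have ne a b : (x a).1 < (x b).1 -> x a != x b.
    by move=> h; apply/eqP => ab; rewrite ab ltxx in h.
  by rewrite -fsetUA cardfsU1 cardfs2 !inE negb_or !ne.
- apply/asboolP; rewrite set_fset3 => /collinear_triangle; rewrite lt_eqF//.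
  by move=> /(_ isT) /eqP; rewrite (negbTE D0).
Qed.
End triangle_index.

(** * Area of a triangle in the unit square *)

Section uniform01.
Context {R : realType}.

Let idR : measurableTypeR R -> R := idfun.

#[local] HB.instance Definition _ :=
  @isMeasurableFun.Build _ _ _ _ idR (@measurable_id _ _ setT).

(* The measurable structure of [R] and that of [measurableTypeR R], on which the
   Lebesgue measure is defined, have the same sets but distinct displays; hence
   the image by the identity. *)
Definition uniform01 : probability R R := distribution (uniform_prob (@ltr01 R)) idR.

Lemma integral_uniform01 (f : R -> \bar R) :
  measurable_fun setT f -> (forall x, 0 <= f x)%E ->
  (\int[uniform01]_x f x = \int[lebesgue_measure]_(x in `[0%R, 1%R]) f x)%E.
Proof.
move=> mf f0; rewrite ge0_integral_distribution//.
by rewrite integral_uniform// subr0 invr1 mul1e.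
Qed.

Lemma uniform01E (B : set R) : measurable B ->
  uniform01 B = lebesgue_measure (B `&` `[0%R, 1%R]).
Proof.
move=> mB; transitivity (uniform_prob (@ltr01 R) B) => //.
rewrite /uniform_prob integral_uniform_pdf.
under eq_integral.
  move=> x; rewrite inE => -[_ /=]; rewrite in_itv/= => x01.
  rewrite /uniform_pdf x01 subr0 invr1; over.
by rewrite integral_cst ?mul1e//; exact: measurableI.
Qed.

Definition uniform_square : probability (R * R)%type R := (uniform01 \x uniform01)%E.

Lemma uniform_squareX (A B : set R) : measurable A -> measurable B ->
  uniform_square (A `*` B) = (uniform01 A * uniform01 B)%E.
Proof. exact: product_measure1E. Qed.

Lemma integral_uniform_square (f : R * R -> \bar R) :
  measurable_fun setT f -> (forall z, 0 <= f z)%E ->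
  (\int[uniform_square]_z f z = \int[uniform01]_x \int[uniform01]_y f (x, y))%E.
Proof. exact: fubini_tonelli1. Qed.
End uniform01.

Section area.
Context {R : realType}.
Implicit Types p q r z : R * R.
Notation u := (@uniform01 R).
Notation leb := (@lebesgue_measure R).

Section measurability.
Context d (E : measurableType d).
Implicit Types f g h k : E -> R * R.

Lemma measurable_cross f g h : measurable_fun setT f -> measurable_fun setT g ->
  measurable_fun setT h -> measurable_fun setT (fun v => cross (f v) (g v) (h v)).
Proof.
move=> mf mg mh; rewrite /cross.
have m1 k : measurable_fun setT k -> measurable_fun setT (fun v => (k v).1).
  exact: (measurableT_comp measurable_fst).
have m2 k : measurable_fun setT k -> measurable_fun setT (fun v => (k v).2).
  exact: (measurableT_comp measurable_snd).
by apply: measurable_funB; apply: measurable_funM; apply: measurable_funB;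
  do ?[exact: m1|exact: m2].
Qed.

Lemma measurable_inside f g h k : measurable_fun setT f -> measurable_fun setT g ->
  measurable_fun setT h -> measurable_fun setT k ->
  measurable [set v | inside (f v) (g v) (h v) (k v)].
Proof.
move=> mf mg mh mk.
rewrite -[X in measurable X]setTI.
apply: (_ : measurable_fun setT (fun v => inside (f v) (g v) (h v) (k v))) => //.
rewrite /inside; do ?apply: measurable_and; apply: measurable_fun_ltr => //;
  by apply: measurable_funM; exact: measurable_cross.
Qed.
End measurability.

Lemma integral_deriv_poly (Q : {poly R}) (a b : R) : a <= b ->
  (\int[leb]_(x in `[a, b]) (Q^`().[x])%:E = (Q.[b] - Q.[a])%:E)%E.
Proof.
rewrite le_eqVlt => /predU1P[->|ab].
  by rewrite set_itv1 integral_set1 subrr.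
rewrite (@continuous_FTC2 _ (horner Q^`()) (horner Q)) ?EFinB//.
- by apply: continuous_subspaceT => x; exact: continuous_horner.
- split.
  + by move=> x _; exact: derivable_horner.
  + by apply: cvg_at_right_filter; exact: continuous_horner.
  + by apply: cvg_at_left_filter; exact: continuous_horner.
- by move=> x _; rewrite derive.derivE.
Qed.

Lemma uniform01_oo (a b : R) : 0 <= a -> a <= b -> b <= 1 ->
  u [set` `]a, b[] = (b - a)%:E.
Proof.
move=> a0 ab b1; rewrite uniform01E// setIidl; last first.
  move=> x /=; rewrite !in_itv/= => /andP[ax xb].
  by rewrite (le_trans a0 (ltW ax)) (le_trans (ltW xb) b1).
rewrite lebesgue_measure_itv/= lte_fin.
move: ab; rewrite le_eqVlt => /predU1P[->|ab]; first by rewrite ltxx subrr.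
by rewrite ab -EFinD.
Qed.

(** The set is the open interval between [L] and [L + e * t]; the factor [e] in both inequalities
    covers the two possible orders of the endpoints at once. Both endpoints lie in the unit
    interval, so nothing is cut off. *)
Lemma uniform01_signed (e L t : R) : 0 <= t -> 0 <= L <= 1 -> 0 <= L + e * t <= 1 ->
  u [set y | (0 < e * (y - L)) && (e * (y - (L + e * t)) < 0)] = (`|e| * t)%:E.
Proof.
move=> t0 /andP[L0 L1] /andP[M0 M1].
have [e0|e0|->] := ltgtP e 0.
- rewrite (_ : mkset _ = [set` `]L + e * t, L[]).
    rewrite uniform01_oo// ?ltr0_norm//; last by rewrite gerDl mulr_le0_ge0// ltW.
    by congr EFin; ring.
  apply/seteqP; split=> y /=; rewrite in_itv/= nmulr_rgt0// nmulr_rlt0// subr_lt0 subr_gt0 andbC//.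
- rewrite (_ : mkset _ = [set` `]L, L + e * t[]).
    rewrite uniform01_oo// ?gtr0_norm//; last by rewrite lerDl mulr_ge0// ltW.
    by congr EFin; ring.
  by apply/seteqP; split=> y /=; rewrite in_itv/= pmulr_rgt0// pmulr_rlt0// subr_lt0 subr_gt0.
- rewrite (_ : mkset _ = set0) ?measure0 ?normr0 ?mul0r//.
  by apply/seteqP; split=> y //=; rewrite mul0r ltxx.
Qed.

Section triangle.
Variables p q r : R * R.
Hypotheses (pq : p.1 < q.1) (qr : q.1 < r.1).
Let pr : p.1 < r.1. Proof. exact: lt_trans qr. Qed.
(** [e] is the signed height of [q] above the line [pr], whose ordinate at [x] is [base x]. The
    lines [pq] and [qr] have ordinates [base x + e * tl x] and [base x + e * tr x]. *)
Let e : R := - cross p q r / (r.1 - p.1).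
Let base (x : R) : R := p.2 + (r.2 - p.2) / (r.1 - p.1) * (x - p.1).
Let tl (x : R) : R := (x - p.1) / (q.1 - p.1).
Let tr (x : R) : R := (r.1 - x) / (r.1 - q.1).

Let n1 : q.1 - p.1 != 0. Proof. by rewrite subr_eq0 gt_eqF. Qed.
Let n2 : r.1 - q.1 != 0. Proof. by rewrite subr_eq0 gt_eqF. Qed.
Let n3 : r.1 - p.1 != 0. Proof. by rewrite subr_eq0 gt_eqF. Qed.
Let g1 : 0 < q.1 - p.1. Proof. by rewrite subr_gt0. Qed.
Let g2 : 0 < r.1 - q.1. Proof. by rewrite subr_gt0. Qed.
Let g3 : 0 < r.1 - p.1. Proof. by rewrite subr_gt0. Qed.

Lemma inside_baseE x y : inside p q r (x, y) =
  [&& e * (y - (base x + e * tl x)) < 0, e * (y - (base x + e * tr x)) < 0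
    & 0 < e * (y - base x)].
Proof.
rewrite /inside; congr [&& _, _ & _].
- have -> : cross p q r * cross p q (x, y) =
    ((r.1 - p.1) * (q.1 - p.1)) * - (e * (y - (base x + e * tl x))).
    by rewrite /e /base /tl /cross /=; field; rewrite n1 n3.
  by rewrite pmulr_rgt0 ?mulr_gt0// oppr_gt0.
- have -> : cross p q r * cross q r (x, y) =
    ((r.1 - p.1) * (r.1 - q.1)) * - (e * (y - (base x + e * tr x))).
    by rewrite /e /base /tr /cross /=; field; rewrite n2 n3.
  by rewrite pmulr_rgt0 ?mulr_gt0// oppr_gt0.
- have -> : cross p q r * cross r p (x, y) =
    ((r.1 - p.1) * (r.1 - p.1)) * (e * (y - base x)).
    by rewrite /e /base /cross /=; field; rewrite n3.
  by rewrite pmulr_rgt0//; exact: mulr_gt0.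
Qed.

Lemma conv01 (a b t : R) : 0 <= a <= 1 -> 0 <= b <= 1 -> 0 <= t <= 1 ->
  0 <= (1 - t) * a + t * b <= 1.
Proof.
move=> /andP[a0 a1] /andP[b0 b1] /andP[t0 t1].
have t1' : 0 <= 1 - t by rewrite subr_ge0.
rewrite addr_ge0 ?mulr_ge0//=.
have : (1 - t) * a <= (1 - t) * 1 by exact: ler_wpM2l.
have : t * b <= t * 1 by exact: ler_wpM2l.
lra.
Qed.

Lemma frac01 (a b : R) : 0 <= a -> a <= b -> 0 < b -> 0 <= a / b <= 1.
Proof.
by move=> a0 ab b0; rewrite divr_ge0 ?(ltW b0)//= ler_pdivrMr// mul1r.
Qed.

Hypotheses (p01 : 0 <= p.2 <= 1) (q01 : 0 <= q.2 <= 1) (r01 : 0 <= r.2 <= 1).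

Let base01 x : p.1 <= x <= r.1 -> 0 <= base x <= 1.
Proof.
move=> /andP[px xr].
have -> : base x = (1 - (x - p.1) / (r.1 - p.1)) * p.2 + (x - p.1) / (r.1 - p.1) * r.2.
  by rewrite /base; field; rewrite n3.
by apply: conv01 => //; apply: frac01 => //; rewrite ?subr_ge0 ?lerD2r.
Qed.

(** Left of [q], [tl x <= 1 <= tr x], so the test for the edge [qr] follows from the one for [pq],
    and the section is the interval between the lines [pr] and [pq]. *)
Lemma section_inside_left x : p.1 <= x <= q.1 ->
  u (xsection [set z | inside p q r z] x) = (`|e| * tl x)%:E.
Proof.
move=> /andP[px xq].
have /andP[t0 t1] : 0 <= tl x <= 1 by apply: frac01 => //; rewrite ?subr_ge0 ?lerD2r.
have ts : 1 <= tr x by rewrite /tr ler_pdivlMr// mul1r lerD2l lerN2.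
rewrite -(@uniform01_signed e (base x)) //; last 2 first.
- by apply: base01; rewrite px (le_trans xq)// ltW.
- have -> : base x + e * tl x = (1 - tl x) * p.2 + tl x * q.2.
    by rewrite /base /e /tl /cross; field; rewrite n1 n3.
  by apply: conv01 => //; rewrite t0 t1.
congr (u _); apply/seteqP; split=> y; rewrite /xsection /= inE /= inside_baseE.
  by move=> /and3P[-> _ ->].
move=> /andP[h1 h2]; rewrite h1 h2 ?andbT/= ?andbT.
apply: le_lt_trans h2; rewrite -subr_ge0.
have -> : e * (y - (base x + e * tl x)) - e * (y - (base x + e * tr x)) =
  e * e * (tr x - tl x) by ring.
by rewrite mulr_ge0 ?subr_ge0 ?(le_trans t1)// -expr2 sqr_ge0.
Qed.

Lemma section_inside_right x : q.1 <= x <= r.1 ->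
  u (xsection [set z | inside p q r z] x) = (`|e| * tr x)%:E.
Proof.
move=> /andP[qx xr].
have /andP[t0 t1] : 0 <= tr x <= 1 by apply: frac01 => //; rewrite ?subr_ge0 ?lerD2l ?lerN2.
have ts : 1 <= tl x by rewrite /tl ler_pdivlMr// mul1r lerD2r.
rewrite -(@uniform01_signed e (base x)) //; last 2 first.
- by apply: base01; rewrite xr (le_trans _ qx)// ltW.
- have -> : base x + e * tr x = (1 - tr x) * r.2 + tr x * q.2.
    by rewrite /base /e /tr /cross; field; rewrite n2 n3.
  by apply: conv01 => //; rewrite t0 t1.
congr (u _); apply/seteqP; split=> y; rewrite /xsection /= inE /= inside_baseE.
  by move=> /and3P[_ -> ->].
move=> /andP[h1 h2]; rewrite h1 h2 ?andbT/= ?andbT.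
apply: le_lt_trans h2; rewrite -subr_ge0.
have -> : e * (y - (base x + e * tr x)) - e * (y - (base x + e * tl x)) =
  e * e * (tl x - tr x) by ring.
by rewrite mulr_ge0 ?subr_ge0 ?(le_trans t1)// -expr2 sqr_ge0.
Qed.

Lemma section_inside_out x : ~~ (p.1 <= x <= r.1) ->
  u (xsection [set z | inside p q r z] x) = 0%E.
Proof.
move=> px; rewrite (_ : xsection _ _ = set0) ?measure0//.
apply/seteqP; split=> y //; rewrite /xsection /= inE /= inside_baseE => /and3P[h1 h2 h3].
have ee : 0 <= e * e by rewrite -expr2 sqr_ge0.
move: px; rewrite negb_and -!ltNge => /orP[xp|rx].
- have : e * e * tl x <= 0.
    apply: mulr_ge0_le0 => //; apply: mulr_le0_ge0; rewrite ?subr_le0 ?invr_ge0; exact: ltW.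
  by lra.
- have : e * e * tr x <= 0.
    apply: mulr_ge0_le0 => //; apply: mulr_le0_ge0; rewrite ?subr_le0 ?invr_ge0; exact: ltW.
  by lra.
Qed.

Hypotheses (p101 : 0 <= p.1) (r101 : r.1 <= 1).

Lemma uniform_square_inside :
  uniform_square [set z | inside p q r z] = (`|cross p q r| / 2)%:E.
Proof.
transitivity (\int[u]_x (u (xsection [set z | inside p q r z] x)))%E => //.
rewrite integral_uniform01//; last exact/measurable_fun_xsection/measurable_inside.
transitivity (\int[leb]_(x in `[p.1, r.1]) (u (xsection [set z | inside p q r z] x)))%E.
  rewrite integral_mkcond [RHS]integral_mkcond; apply: eq_integral => x _.
  rewrite !patchE; case: ifPn => x01; case: ifPn => // xpr.
    by rewrite section_inside_out//; move: xpr; rewrite notin_setE/= in_itv/= => /negP.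
  move: xpr x01; rewrite inE notin_setE /= !in_itv/= => /andP[px xr] [].
  by rewrite (le_trans p101 px) (le_trans xr r101).
rewrite (_ : [set` `[p.1, r.1]] = `[p.1, q.1] `|` `]q.1, r.1]); last first.
  by rewrite -itv_bndbnd_setU// bnd_simp ltW.
rewrite ge0_integral_setU//=; last 2 first.
- exact/measurable_funTS/measurable_fun_xsection/measurable_inside.
- rewrite disj_set2E; apply/eqP/seteqP; split=> x //= []; rewrite !in_itv/=.
  by move=> /andP[_ xq] /andP[qx _]; move: (le_lt_trans xq qx); rewrite ltxx.
rewrite integral_itv_obnd_cbnd; last first.
  exact/measurable_funTS/measurable_fun_xsection/measurable_inside.
(* Antiderivatives of the section lengths on the two sides of [q]; each vanishes at the outer vertex
   of its side. *)
pose Q1 : {poly R} := (`|e| / (2 * (q.1 - p.1))) *: ('X - p.1%:P) ^+ 2.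
pose Q2 : {poly R} := - (`|e| / (2 * (r.1 - q.1))) *: (r.1%:P - 'X) ^+ 2.
under eq_integral => x.
  rewrite inE/= in_itv/= => px; rewrite section_inside_left//.
  rewrite (_ : _ * _ = Q1^`().[x]); last first.
    by rewrite /Q1 /tl !poly.derivE !hornerE/=; field.
  over.
rewrite integral_deriv_poly ?ltW//.
under eq_integral => x.
  rewrite inE/= in_itv/= => px; rewrite section_inside_right//.
  rewrite (_ : _ * _ = Q2^`().[x]); last first.
    by rewrite /Q2 /tr !poly.derivE !hornerE/=; field.
  over.
rewrite integral_deriv_poly ?ltW//.
have -> : `|cross p q r| = `|e| * (r.1 - p.1).
  by rewrite /e normrM normrN normfV (gtr0_norm g3) mulfVK.
rewrite -EFinD; congr EFin; rewrite /Q1 /Q2 !hornerE /=; field.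
by rewrite n1 n2.
Qed.
End triangle.
End area.

(** * Binomial tails *)

Section binomial_tail.
Context {R : realType}.
Notation leb := (@lebesgue_measure R).

(** The function [B] of the overview, kept as a polynomial so that integrals reduce to formal
    derivatives. *)
Definition binomial_tail (m s : nat) : {poly R} :=
  1 - \sum_(i < s.+1) 'C(m.+1, i)%:R *: ('X^i * (1 - 'X) ^+ (m.+1 - i)).

Lemma deriv_XnM1BXn (i k : nat) :
  deriv ('X^i * (1 - 'X) ^+ k : {poly R}) =
  i%:R *: ('X^(i.-1) * (1 - 'X) ^+ k) - k%:R *: ('X^i * (1 - 'X) ^+ k.-1).
Proof.
rewrite derivM derivXn deriv_exp derivB derivX -polyC1 derivC sub0r.
by rewrite mulN1r mulNrn mulrN mulrnAl mulrnAr !scaler_nat.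
Qed.

(** The derivatives of successive terms telescope. The result is the density of the order statistic
    of rank [s + 1] among [m + 1] uniform variables. *)
Lemma deriv_binomial_tail m s : (s <= m)%N ->
  (binomial_tail m s)^`() = (m.+1 * 'C(m, s))%:R *: ('X^s * (1 - 'X) ^+ (m - s)).
Proof.
rewrite /binomial_tail derivB -polyC1 derivC sub0r.
elim: s => [|s IH] sm.
  rewrite big_ord1 derivZ deriv_XnM1BXn !bin0 !subn0 muln1 !scale1r scale0r.
  by rewrite sub0r opprK.
rewrite big_ord_recr /= derivD opprD IH ?(ltnW sm)// derivZ deriv_XnM1BXn /=.
rewrite scalerBr !scalerA -!natrM subSS.
have -> : ('C(m.+1, s.+1) * s.+1 = m.+1 * 'C(m, s))%N by rewrite mulnC -mul_bin_diag.
have -> : ('C(m.+1, s.+1) * (m - s) = m.+1 * 'C(m, s.+1))%N.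
  by rewrite mulnC mul_bin_down.
by rewrite opprB addrC subrK -subnS.
Qed.

Lemma binomial_tail0 m s : (binomial_tail m s).[0] = 0.
Proof.
rewrite /binomial_tail !hornerE horner_sum big_ord_recl /= big1 => [|i _].
  by rewrite !hornerE /= subr0 expr1n subrr.
by rewrite !hornerE /= expr0n !(mulr0, mul0r).
Qed.

Lemma binomial_tail_le1 m s (t : R) : 0 <= t <= 1 -> (binomial_tail m s).[t] <= 1.
Proof.
move=> /andP[t0 t1]; rewrite /binomial_tail !hornerE gerDl oppr_le0 horner_sum.
apply: sumr_ge0 => i _; rewrite !hornerE /=.
by rewrite !mulr_ge0// exprn_ge0// subr_ge0.
Qed.

Lemma binomial_tail_homo m s (t t' : R) : (s <= m)%N -> 0 <= t -> t <= t' -> t' <= 1 ->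
  (binomial_tail m s).[t] <= (binomial_tail m s).[t'].
Proof.
move=> sm t0 tt' t'1; rewrite -subr_ge0 -lee_fin -integral_deriv_poly//.
apply: integral_ge0 => x /=; rewrite in_itv /= => /andP[tx xt].
rewrite lee_fin deriv_binomial_tail// !hornerE /= !mulr_ge0// exprn_ge0//.
  exact: le_trans tx.
by rewrite subr_ge0 (le_trans xt).
Qed.

(** One of the nonnegative terms in the expansion of [(y + (1 - y)) ^+ n = 1]. *)
Lemma binomial_term_le1 n i (y : R) : 0 <= y <= 1 -> (i <= n)%N ->
  'C(n, i)%:R * ((1 - y) ^+ i * y ^+ (n - i)) <= 1.
Proof.
move=> /andP[y0 y1] lein.
have := exprDn y (1 - y) n; rewrite addrC subrK expr1n => E; rewrite [leRHS]E {E}.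
rewrite (bigD1 (Ordinal (lein : (i < n.+1)%N)))//= mulr_natl mulrC lerDl.
by apply: sumr_ge0 => j _; rewrite mulrn_wge0// mulr_ge0// exprn_ge0// subr_ge0.
Qed.

Lemma binomial_term_cvg i (t : R) : 0 < t < 1 ->
  (fun n => 'C(n, i)%:R * (t ^+ i * (1 - t) ^+ (n - i))) @ \oo --> (0 : R).
Proof.
move=> /andP[t0 t1].
(* The term for the parameter [1 - y = t / 2] is at most 1, and the term for [t]
   is [2 ^ i * ((1 - t) / y) ^ (n - i)] times it, with [(1 - t) / y < 1]. *)
pose y := 1 - t / 2.
have y01 : 0 < y < 1 by rewrite /y; apply/andP; split; lra.
have /andP[y0 y1] := y01.
have t1' : 0 <= 1 - t by rewrite subr_ge0 ltW.
have t0' := ltW t0; have y0' := ltW y0; have y1' := ltW y1.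
pose z := (1 - t) / y.
have z0 : 0 <= z by exact: divr_ge0.
have z01 : `|z| < 1.
  rewrite ger0_norm; last exact: divr_ge0.
  by rewrite ltr_pdivrMr// mul1r /y; lra.
rewrite -(cvg_shiftn i).
have H : (fun n => 2 ^+ i * z ^+ n) @ \oo --> (0 : R).
  rewrite -[X in _ --> X](mulr0 (2 ^+ i : R)); apply: cvgM; first exact: cvg_cst.
  exact: cvg_expr.
apply: (squeeze_cvgr _ (cvg_cst 0) H); apply: nearW => n /=.
rewrite addnK !mulr_ge0 ?exprn_ge0//=.
have := @binomial_term_le1 (n + i) i y _ (leq_addl _ _).
rewrite addnK y0' y1' => /(_ isT).
have -> : 1 - y = t / 2 by rewrite /y; ring.
move=> h.
have -> : 'C(n + i, i)%:R * (t ^+ i * (1 - t) ^+ n) =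
  ('C(n + i, i)%:R * ((t / 2) ^+ i * y ^+ n)) * (2 ^+ i * z ^+ n).
  rewrite /z !exprMn !exprVn.
  have y'0 : y ^+ n != 0 by rewrite expf_neq0// gt_eqF.
  have i'0 : 2 ^+ i != 0 :> R by rewrite expf_neq0.
  move: (y ^+ n) (2 ^+ i) y'0 i'0 => Y D Y0 D0.
  by field; rewrite D0 Y0.
by rewrite -[leRHS]mul1r ler_wpM2r// mulr_ge0 ?exprn_ge0.
Qed.

(** The complement of the tail is a sum of [s + 1] terms, a number independent of [m], each tending
    to 0. *)
Lemma binomial_tail_cvg s (t : R) : 0 < t < 1 ->
  (fun m => (binomial_tail m s).[t]) @ \oo --> (1 : R).
Proof.
move=> t01.
rewrite -[X in _ --> X]subr0.
under eq_cvg => m do rewrite /binomial_tail !hornerE horner_sum.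
apply: cvgB; first exact: cvg_cst.
rewrite [X in _ --> X](_ : 0 = \sum_(i < s.+1) (0 : R)); last by rewrite big1.
apply: (cvg_big (op := +%R)) => [|i _]; first exact: add_continuous.
have := binomial_term_cvg i t01; rewrite -(cvg_shiftS).
move=> H; rewrite [X in X @ _](_ : _ =
    (fun n => 'C(n.+1, i)%:R * (t ^+ i * (1 - t) ^+ (n.+1 - i)))); first exact: H.
by apply/funext => m; rewrite !hornerE.
Qed.
End binomial_tail.

(** * Integration over the middle vertex *)

Section middle_vertex.
Context {R : realType}.
Implicit Types p q r z : R * R.
Notation u := (@uniform01 R).
Notation leb := (@lebesgue_measure R).

(** The open square loses only a null set and keeps the height [h] of the line [pr] strictly between
    0 and 1, without which the tails at [w h] and [w (1 - h)] need not tend to 1. *)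
Definition in_open_square z : bool := (0 < z.1 < 1) && (0 < z.2 < 1).

Definition generic_triangle p q r : bool :=
  [&& in_open_square p, in_open_square q, in_open_square r & triangle_lr p q r].

Lemma measurable_in_open_square d (E : measurableType d) (f : E -> R * R) :
  measurable_fun setT f -> measurable_fun setT (fun v => in_open_square (f v)).
Proof.
move=> mf; rewrite /in_open_square.
have m1 : measurable_fun setT (fun v => (f v).1) by exact: (measurableT_comp measurable_fst).
have m2 : measurable_fun setT (fun v => (f v).2) by exact: (measurableT_comp measurable_snd).
by do ?apply: measurable_and; apply: measurable_fun_ltr.
Qed.

Lemma measurable_generic_triangle d (E : measurableType d) (f g h : E -> R * R) :
  measurable_fun setT f -> measurable_fun setT g -> measurable_fun setT h ->
  measurable_fun setT (fun v => generic_triangle (f v) (g v) (h v)).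
Proof.
move=> mf mg mh; rewrite /generic_triangle /triangle_lr.
have m1 k : measurable_fun setT k -> measurable_fun setT (fun v : E => (k v : R * R).1).
  exact: (measurableT_comp measurable_fst).
apply: measurable_and; first exact: measurable_in_open_square.
apply: measurable_and; first exact: measurable_in_open_square.
apply: measurable_and; first exact: measurable_in_open_square.
apply: measurable_and; first by apply: measurable_fun_ltr; [exact: (m1 f)|exact: (m1 g)].
apply: measurable_and; first by apply: measurable_fun_ltr; [exact: (m1 g)|exact: (m1 h)].
apply: measurable_neg; apply: measurable_fun_eqr => //; exact: measurable_cross.
Qed.

(* The factor [m.+1] is what makes the integral converge to a nonzero limit. *)
Definition triangle_weight m s (v : (R * R) * (R * R) * (R * R)) : R :=
  if generic_triangle v.1.1 v.2 v.1.2 then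
    (m.+1 * 'C(m, s))%:R * ((`|cross v.1.1 v.2 v.1.2| / 2) ^+ s *
      (1 - `|cross v.1.1 v.2 v.1.2| / 2) ^+ (m - s))
  else 0.

Lemma measurable_triangle_weight m s : measurable_fun setT (triangle_weight m s).
Proof.
have m11 : measurable_fun setT (fun v : (R * R) * (R * R) * (R * R) => v.1.1).
  exact: (measurableT_comp measurable_fst measurable_fst).
have m12 : measurable_fun setT (fun v : (R * R) * (R * R) * (R * R) => v.1.2).
  exact: (measurableT_comp measurable_snd measurable_fst).
have m2 : measurable_fun setT (fun v : (R * R) * (R * R) * (R * R) => v.2).
  exact: measurable_snd.
have mc : measurable_fun setT (fun v : (R * R) * (R * R) * (R * R) =>
    `|cross v.1.1 v.2 v.1.2| / 2).
  by apply: measurable_funM => //; apply: measurableT_comp => //; exact: measurable_cross.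
apply: measurable_fun_ifT => //.
  exact: measurable_generic_triangle.
apply: measurable_funM => //; apply: measurable_funM; apply: measurable_funX => //.
exact: measurable_funB.
Qed.

(** A crude bound, 1 for each of the two products; it makes the area at most 1, hence the powers of
    its complement nonnegative. *)
Lemma cross_le1 p q r : in_open_square p -> in_open_square q -> in_open_square r ->
  `|cross p q r| <= 2.
Proof.
move=> /andP[/andP[p1 p1'] /andP[p2 p2']] /andP[/andP[q1 q1'] /andP[q2 q2']].
move=> /andP[/andP[r1 r1'] /andP[r2 r2']].
have H (a b c d : R) : 0 < a -> a < 1 -> 0 < b -> b < 1 -> 0 < c -> c < 1 ->
    0 < d -> d < 1 -> `|(a - b) * (c - d)| <= 1.
  move=> *; rewrite normrM -[leRHS]mulr1; apply: ler_pM => //;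
  by rewrite ler_norml; apply/andP; split; lra.
by rewrite /cross; apply: (le_trans (ler_normB _ _)); apply: lerD; exact: H.
Qed.

Lemma triangle_weight_ge0 m s v : 0 <= triangle_weight m s v.
Proof.
rewrite /triangle_weight; case: ifP => // /and4P[pS qS rS _].
rewrite !mulr_ge0// exprn_ge0// ?divr_ge0// subr_ge0 ler_pdivrMr// mul1r.
exact: cross_le1.
Qed.

Section slice.
Variables (m s : nat) (p r : R * R).
Hypotheses (sm : (s <= m)%N) (pS : in_open_square p) (rS : in_open_square r)
  (pr : p.1 < r.1).
Let w : R := (r.1 - p.1) / 2.
Let h (x : R) : R := p.2 + (x - p.1) / (r.1 - p.1) * (r.2 - p.2).
Notation B := (binomial_tail m s).

Let w_gt0 : 0 < w. Proof. by rewrite divr_gt0// subr_gt0. Qed.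

Let lo : R := Num.min p.2 r.2.
Let hi : R := Num.max p.2 r.2.

Let h_bounds x : p.1 < x < r.1 -> lo <= h x <= hi.
Proof.
move=> /andP[px xr]; have := @frac01 _ (x - p.1) (r.1 - p.1).
rewrite subr_ge0 lerD2r subr_gt0 (ltW px) (ltW xr) pr => /(_ isT isT isT).
rewrite /h; move: (_ / _) => t /andP[t0 t1].
have -> : p.2 + t * (r.2 - p.2) = (1 - t) * p.2 + t * r.2 by ring.
have t1' : 0 <= 1 - t by rewrite subr_ge0.
have lp : lo <= p.2 by rewrite ge_min lexx.
have lr : lo <= r.2 by rewrite ge_min lexx orbT.
have hp : p.2 <= hi by rewrite le_max lexx.
have hr : r.2 <= hi by rewrite le_max lexx orbT.
have a1 := ler_wpM2l t1' lp; have a2 := ler_wpM2l t0 lr.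
have a3 := ler_wpM2l t1' hp; have a4 := ler_wpM2l t0 hr.
move: (lo) (hi) a1 a2 a3 a4 => a b; lra.
Qed.

Let lo_gt0 : 0 < lo.
Proof. by move: pS rS => /and3P[_ p0 _] /and3P[_ r0 _]; rewrite lt_min p0. Qed.

Let hi_lt1 : hi < 1.
Proof. by move: pS rS => /and3P[_ _ p1] /and3P[_ _ r1]; rewrite gt_max p1. Qed.

Lemma integral_weight_vertical x : p.1 < x < r.1 ->
  (\int[u]_y (triangle_weight m s ((p, r), (x, y)))%:E =
    (w^-1 * (B.[w * h x] + B.[w * (1 - h x)]))%:E)%E.
Proof.
move=> /andP[px xr].
have h01 : 0 < h x < 1.
  have /andP[h0 h1] : lo <= h x <= hi by apply: h_bounds; rewrite px.
  by rewrite (lt_le_trans lo_gt0 h0) (le_lt_trans h1 hi_lt1).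
have mf : measurable_fun setT (fun y => (triangle_weight m s ((p, r), (x, y)))%:E).
  apply/measurable_EFinP; apply: (measurableT_comp (measurable_triangle_weight m s)).
  by apply: measurable_fun_pair => //; apply: measurable_fun_pair.
have /andP[h0 h1] := h01.
rewrite integral_uniform01//; last by move=> y; rewrite lee_fin triangle_weight_ge0.
have crossE y : `|cross p (x, y) r| / 2 = w * `|y - h x|.
  have -> : cross p (x, y) r = - (2 * w) * (y - h x).
    by rewrite /cross /w /h /=; field; rewrite subr_eq0 gt_eqF.
  have w2 : 0 < 2 * w by exact: mulr_gt0.
  by rewrite mulNr normrN normrM (gtr0_norm w2); field.
have wE y : 0 < y < 1 -> y != h x -> triangle_weight m s ((p, r), (x, y)) =
    (m.+1 * 'C(m, s))%:R * ((w * `|y - h x|) ^+ s * (1 - w * `|y - h x|) ^+ (m - s)).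
  move=> y01 yh; rewrite /triangle_weight /= crossE ifT//.
  rewrite /generic_triangle pS rS /triangle_lr px xr /in_open_square /= y01.
  move: pS rS => /andP[/andP[p0 _] _] /andP[/andP[_ r1] _].
  rewrite (lt_trans p0 px) (lt_trans xr r1)/=.
  apply: contraNneq yh => c0; have := crossE y; rewrite c0 normr0 mul0r => /esym/eqP.
  by rewrite mulf_eq0 (gt_eqF w_gt0)/= normr_eq0 subr_eq0.
rewrite (_ : [set` `[0%R, 1%R]] = `[0, h x[ `|` `[h x, 1]); last first.
  by rewrite -itv_bndbnd_setU// bnd_simp ltW.
rewrite ge0_integral_setU//=; last 3 first.
- exact: measurable_funTS.
- by move=> y _; rewrite lee_fin triangle_weight_ge0.
- rewrite disj_set2E; apply/eqP/seteqP; split=> y //= []; rewrite !in_itv/=.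
  by move=> /andP[_ yh] /andP[hy _]; move: (lt_le_trans yh hy); rewrite ltxx.
(* Endpoints are dropped because the weight is 0 there by definition, whereas at [h x] the closed
   formula is not when [s = 0]. They are restored once the integrand is a polynomial. *)
rewrite (@integral_itv_bndoo _ 0 (h x) _ true true); last exact: measurable_funTS.
rewrite (@integral_itv_bndoo _ (h x) 1 _ true false); last exact: measurable_funTS.
(* Antiderivatives below and above [h x]: the factor [w^-1] undoes the inner derivative, and both
   vanish at [h x] because the tail is 0 at 0. *)
pose Q1 : {poly R} := - w^-1 *: (B \Po (w *: ((h x)%:P - 'X))).
pose Q2 : {poly R} := w^-1 *: (B \Po (w *: ('X - (h x)%:P))).
have Q1E y : Q1^`().[y] = (m.+1 * 'C(m, s))%:R *
    ((w * (h x - y)) ^+ s * (1 - w * (h x - y)) ^+ (m - s)).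
  rewrite /Q1 derivZ deriv_comp deriv_binomial_tail// !hornerE horner_comp !hornerE /=.
  rewrite derivZ derivB derivC derivX !hornerE /=.
  have w0 : r.1 - p.1 != 0 by rewrite subr_eq0 gt_eqF.
  move: (_ ^+ s) (_ ^+ (m - s)) => a b.
  by rewrite /w; field.
have Q2E y : Q2^`().[y] = (m.+1 * 'C(m, s))%:R *
    ((w * (y - h x)) ^+ s * (1 - w * (y - h x)) ^+ (m - s)).
  rewrite /Q2 derivZ deriv_comp deriv_binomial_tail// !hornerE horner_comp !hornerE /=.
  rewrite derivZ derivB derivC derivX !hornerE /=.
  have w0 : r.1 - p.1 != 0 by rewrite subr_eq0 gt_eqF.
  move: (_ ^+ s) (_ ^+ (m - s)) => a b.
  by rewrite /w; field.
under eq_integral => y.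
  rewrite inE/= in_itv/= => /andP[y0 yh].
  rewrite wE; last 2 first.
  - by rewrite y0 (lt_trans yh).
  - by rewrite lt_eqF.
  rewrite ltr0_norm ?subr_lt0// opprB -Q1E; over.
under [X in (_ + X)%E]eq_integral => y.
  rewrite inE/= in_itv/= => /andP[hy y1].
  rewrite wE; last 2 first.
  - by rewrite y1 (lt_trans h0).
  - by rewrite gt_eqF.
  rewrite gtr0_norm ?subr_gt0// -Q2E; over.
have mQ (Q : {poly R}) (D : set R) : measurable_fun D (fun y => (Q.[y])%:E).
  apply/measurable_EFinP; apply: measurable_funTS.
  apply: continuous_measurable_fun; exact: continuous_horner.
rewrite -(@integral_itv_bndoo _ 0 (h x) _ true false)//.
rewrite -(@integral_itv_bndoo _ (h x) 1 _ true false)//.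
rewrite !integral_deriv_poly ?(ltW h0) ?(ltW h1)// -EFinD; congr EFin.
have e1 y : (w *: ((h x)%:P - 'X)).[y] = w * (h x - y) by rewrite !hornerE.
have e2 y : (w *: ('X - (h x)%:P)).[y] = w * (y - h x) by rewrite !hornerE.
rewrite /Q1 /Q2 !hornerZ !horner_comp !e1 !e2 !subrr !mulr0 subr0 binomial_tail0.
by ring.
Qed.

(** A lower bound of both [w * h x] and [w * (1 - h x)] that does not depend on [x], so that the
    estimate by the tail at this point comes out of the integral over [x]. *)
Definition weight_margin : R := (r.1 - p.1) / 2 * Num.min (Num.min p.2 r.2) (1 - Num.max p.2 r.2).

Let w_le : w <= 2^-1.
Proof.
rewrite /w; move: pS rS.
by move=> /andP[/andP[p0 _] _] /andP[/andP[_ r1] _]; lra.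
Qed.

Lemma weight_margin01 : 0 < weight_margin < 1.
Proof.
rewrite /weight_margin -/w -/lo -/hi.
have m0 : 0 < Num.min lo (1 - hi) by rewrite lt_min lo_gt0 subr_gt0.
have m1 : Num.min lo (1 - hi) <= 1.
  rewrite ge_min; apply/orP; right; rewrite gerBl (le_trans (ltW lo_gt0))//.
  by rewrite /lo /hi ge_min le_max lexx.
have : w * Num.min lo (1 - hi) <= w * 1 by apply: ler_wpM2l => //; exact: ltW.
have : 0 < w * Num.min lo (1 - hi) by exact: mulr_gt0.
move: w_le; move: (w) (Num.min _ _) => a b; lra.
Qed.

Lemma integral_weight_vertical_bounds x : p.1 < x < r.1 ->
  ((2 / w * B.[weight_margin])%:E <=
   \int[u]_y (triangle_weight m s ((p, r), (x, y)))%:E <= (2 / w)%:E)%E.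
Proof.
move=> pxr; rewrite integral_weight_vertical// !lee_fin.
have /andP[h0 h1] := h_bounds pxr.
have iw : 0 <= w^-1 by rewrite invr_ge0 ltW.
have w0 := ltW w_gt0.
have [d0 d1 d2] : [/\ 0 <= Num.min lo (1 - hi), Num.min lo (1 - hi) <= h x &
   Num.min lo (1 - hi) <= 1 - h x].
  split.
  - by rewrite le_min subr_ge0 !ltW.
  - by rewrite ge_min h0.
  - by rewrite ge_min lerD2l lerN2 h1 orbT.
have k0 : 0 <= h x by exact: le_trans d1.
have k1 : 0 <= 1 - h x by exact: le_trans d2.
have [e0 e1] : w * h x <= 1 /\ w * (1 - h x) <= 1.
  have : w * h x <= 1 * h x by apply: ler_wpM2r => //; apply: (le_trans w_le); lra.
  have : w * (1 - h x) <= 1 * (1 - h x) by apply: ler_wpM2r => //; apply: (le_trans w_le); lra.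
  by move: (w * h x) (w * (1 - h x)) k0 k1; move: (h x); split; lra.
have f0 : 0 <= w * h x by exact: mulr_ge0.
have f1 : 0 <= w * (1 - h x) by exact: mulr_ge0.
have g0 : 0 <= weight_margin by rewrite ltW//; case/andP: weight_margin01.
have b0 := binomial_tail_homo sm g0 (ler_wpM2l w0 d1) e0.
have b1 := binomial_tail_homo sm g0 (ler_wpM2l w0 d2) e1.
have b2 : B.[w * h x] <= 1 by apply: binomial_tail_le1; rewrite f0 e0.
have b3 : B.[w * (1 - h x)] <= 1 by apply: binomial_tail_le1; rewrite f1 e1.
rewrite (mulrC 2) -mulrA; apply/andP; split; apply: ler_wpM2l => //.
  by rewrite mulr2n mulrDl mul1r; exact: lerD.
by rewrite -[2]/(1 + 1); exact: lerD.
Qed.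

(** The bounds at fixed abscissa have the factor [2 / w], and the abscissa ranges over an interval
    of length [r.1 - p.1 = 2 * w]: hence the 4. *)
Lemma integral_weight_bounds :
  ((4 * B.[weight_margin])%:E <=
   \int[uniform_square]_q (triangle_weight m s ((p, r), q))%:E <= 4%:E)%E.
Proof.
have mfq : measurable_fun setT (fun q => (triangle_weight m s ((p, r), q))%:E).
  apply/measurable_EFinP; apply: (measurableT_comp (measurable_triangle_weight m s)).
  exact: measurable_fun_pair.
have f0 q : (0 <= (triangle_weight m s ((p, r), q))%:E)%E.
  by rewrite lee_fin triangle_weight_ge0.
rewrite integral_uniform_square//.
have mF : measurable_fun setT (fun x => \int[u]_y (triangle_weight m s ((p, r), (x, y)))%:E)%E.
  exact: (measurable_fun_fubini_tonelli_F (fun q => (triangle_weight m s ((p, r), q))%:E)).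
have F0 x : (0 <= \int[u]_y (triangle_weight m s ((p, r), (x, y)))%:E)%E.
  exact: integral_ge0.
have FE x : ~~ (p.1 < x < r.1) ->
    (\int[u]_y (triangle_weight m s ((p, r), (x, y)))%:E = 0)%E.
  move=> xpr; rewrite integral0_eq// => y _; rewrite /triangle_weight ifF//.
  by apply/negbTE; apply: contra xpr => /and4P[_ _ _ /and3P[-> ->]].
have cE (c : R) : (\int[u]_x ((cst c%:E) \_ `]p.1, r.1[) x = (c * (r.1 - p.1))%:E)%E.
  rewrite -integral_mkcond integral_cst//= uniform01_oo//.
  - by case/andP: pS => /andP[/ltW].
  - exact: ltW.
  - by case/andP: rS => /andP[_ /ltW].
have mc (c : R) : measurable_fun setT ((cst c%:E) \_ `]p.1, r.1[).
  apply/(measurable_restrictT _ _).1 => //.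
have c4 (c : R) : (4 * c)%:E = (2 / w * c * (r.1 - p.1))%:E.
  by congr EFin; rewrite /w; field; rewrite subr_eq0 gt_eqF.
have -> : 4%:E = (2 / w * 1 * (r.1 - p.1))%:E :> \bar R by rewrite -c4 mulr1.
rewrite c4 -!cE.
have B0 : 0 <= 2 / w * B.[weight_margin].
  have /andP[/ltW g0 /ltW g1] := weight_margin01.
  rewrite mulr_ge0//; first by rewrite divr_ge0// ltW.
  by have := binomial_tail_homo sm (lexx 0) g0 g1; rewrite binomial_tail0.
apply/andP; split; apply: ge0_le_integral => //; do ?[exact: mc|exact: mF].
- by move=> x _; rewrite patchE; case: ifP => // _; rewrite lee_fin.
- move=> x _; have [px|px] := boolP (x \in [set` `]p.1, r.1[]).
    by rewrite patchT//; have /andP[] := integral_weight_vertical_bounds (set_mem px).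
  by rewrite patchE (negbTE px) F0.
- move=> x _; have [px|px] := boolP (x \in [set` `]p.1, r.1[]).
    rewrite patchT// mulr1.
    by have /andP[] := integral_weight_vertical_bounds (set_mem px).
  rewrite patchE (negbTE px) le_eqVlt; apply/orP; left; apply/eqP; apply: FE.
  by apply: contra px => px; exact: mem_set.
Qed.
End slice.
End middle_vertex.

(** * Integration over the outer vertices *)

Section limit.
Context {R : realType}.
Implicit Types p q r z : R * R.
Notation u := (@uniform01 R).
Notation usq := (@uniform_square R).
Notation leb := (@lebesgue_measure R).

Definition uniform_square2 : probability ((R * R) * (R * R))%type R := (usq \x usq)%E.
Definition uniform_square3 : probability ((R * R) * (R * R) * (R * R))%type R :=
  (uniform_square2 \x usq)%E.
Notation usq2 := uniform_square2.
Notation usq3 := uniform_square3.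

Let D : set ((R * R) * (R * R)) :=
  [set c | [&& in_open_square c.1, in_open_square c.2 & c.1.1 < c.2.1]].

Let mD : measurable D.
Proof.
rewrite -[D]setTI.
apply: (_ : measurable_fun setT (fun c : (R * R) * (R * R) =>
  [&& in_open_square c.1, in_open_square c.2 & c.1.1 < c.2.1])) => //.
apply: measurable_and; first exact: measurable_in_open_square.
apply: measurable_and; first exact: measurable_in_open_square.
by apply: measurable_fun_ltr; [exact: (measurableT_comp measurable_fst measurable_fst)|
   exact: (measurableT_comp measurable_fst measurable_snd)].
Qed.

(** For [p] in the open square the section is the rectangle to the right of [p], of area [1 - p.1],
    whose mean is 1/2. *)
Let measure_D : usq2 D = (2^-1)%:E.
Proof.
transitivity (\int[usq]_p (usq (xsection D p)))%E => //.
have mS : measurable_fun setT (fun p => usq (xsection D p)).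
  exact: measurable_fun_xsection.
rewrite integral_uniform_square//.
transitivity (\int[u]_x ((EFin \o horner (1 - 'X)) \_ `]0%R, 1%R[) x)%E.
  apply: eq_integral => x _;   have [x01|x01] := boolP (x \in [set` `]0%R, 1%R[]).
    rewrite patchT//.
    transitivity (\int[u]_y (cst (1 - x)%:E \_ `]0%R, 1%R[) y)%E.
      apply: eq_integral => y _; rewrite patchE; case: ifPn => y01.
        rewrite (_ : xsection _ _ = [set` `]x, 1[] `*` [set` `]0, 1[]).
          rewrite uniform_squareX// !uniform01_oo//.
            by rewrite subr0 mule1.
          - by move: x01; rewrite inE/= in_itv/= => /andP[/ltW].
          - by move: x01; rewrite inE/= in_itv/= => /andP[_ /ltW].
        apply/seteqP; split=> -[a b]; rewrite /xsection /D /= inE /=.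
          by move=> /and3P[_ /andP[/andP[_ a1] b01] xa]; rewrite !in_itv/= xa a1.
        rewrite !in_itv/= => -[/andP[xa a1] b01].
        rewrite /in_open_square /= xa a1 b01 !andbT.
        move: x01 y01; rewrite !inE/= !in_itv/= => /andP[x0 x1] ->.
        by rewrite x0 x1 (lt_trans x0 xa).
      rewrite (_ : xsection _ _ = set0) ?measure0//.
      apply/seteqP; split=> z //; rewrite /xsection /D /= inE /=.
      move=> /and3P[/andP[_ y0] _ _]; move: y01.
      by rewrite notin_setE /= in_itv /= y0.
    rewrite -integral_mkcond integral_cst//= uniform01_oo// subr0 mule1/=.
    by rewrite !hornerE.
  rewrite patchE (negbTE x01) integral0_eq// => y _.
  rewrite (_ : xsection _ _ = set0) ?measure0//.
  apply/seteqP; split=> z //; rewrite /xsection /D /= inE /=.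
  move=> /and3P[/andP[x0 _] _ _]; move: x01.
  by rewrite notin_setE /= in_itv /= x0.
have mh : measurable_fun setT (EFin \o horner (1 - 'X : {poly R})).
  by apply/measurable_EFinP; apply: continuous_measurable_fun; exact: continuous_horner.
rewrite integral_uniform01; last 2 first.
- by apply/(measurable_restrictT _ _).1 => //; exact: measurable_funTS.
- move=> x; rewrite patchE; case: ifPn => //; rewrite inE/= in_itv/= => /andP[_ x1].
  by rewrite lee_fin !hornerE/= subr_ge0 ltW.
rewrite -integral_mkcondr setIidr; last exact: subset_itv_oo_cc.
rewrite -(@integral_itv_bndoo _ _ _ _ true false)//; last exact: measurable_funTS.
pose Q : {poly R} := 'X - 2^-1 *: 'X ^+ 2.
transitivity (\int[leb]_(x in `[0%R, 1%R]) (Q^`().[x])%:E)%E.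
  by apply: eq_integral => x _; rewrite /Q /= !poly.derivE !hornerE/=; congr EFin; field.
transitivity (Q.[1] - Q.[0])%:E; first exact: (integral_deriv_poly Q ler01).
by rewrite /Q !hornerE/=; congr EFin; field.
Qed.

(** Dominated convergence over the outer vertices: the integral over the middle one is 0 off [D], at
    most 4 everywhere, and tends to 4 on [D], where it is squeezed by the tail at [weight_margin].
    Writing [m = k + s] ensures [s <= m]. *)
Lemma triangle_weight_cvg s :
  (fun k => \int[usq3]_v (triangle_weight (k + s) s v)%:E)%E
    @ \oo --> 2%:E.
Proof.
pose G m (c : (R * R) * (R * R)) := (\int[usq]_q (triangle_weight m s (c, q))%:E)%E.
have mw m : measurable_fun setT (EFin \o triangle_weight m s : _ -> \bar R).
  by apply/measurable_EFinP; exact: measurable_triangle_weight.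
have w0 m (v : (R * R) * (R * R) * (R * R)) : (0 <= (triangle_weight m s v)%:E)%E.
  by rewrite lee_fin triangle_weight_ge0.
have GE m : (\int[usq3]_v (triangle_weight m s v)%:E =
    \int[usq2]_c G m c)%E.
  exact: (@fubini_tonelli1 _ _ _ _ R usq2 usq _ (mw m) (w0 m)).
under eq_cvg => k do rewrite GE.
have mG m : measurable_fun setT (G m).
  exact: (measurable_fun_fubini_tonelli_F _ (mw m) (w0 m)).
have G0 m c : ~ D c -> G m c = 0%E.
  move=> Dc; rewrite /G integral0_eq// => q _; rewrite /triangle_weight ifF//.
  apply/negP => /and4P[pS qS rS /and3P[pq qr _]]; apply: Dc.
  by rewrite /D /= pS rS (lt_trans pq qr).
have Gb m c : (s <= m)%N -> D c ->
    ((4 * (binomial_tail m s).[weight_margin c.1 c.2])%:E <= G m c <= 4%:E)%E.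
  case: c => p r sm /and3P[pS rS pr].
  exact: integral_weight_bounds.
have G4 m c : (s <= m)%N -> (`|G m c| <= 4%:E)%E.
  move=> sm; rewrite gee0_abs; last exact: integral_ge0.
  have [Dc|Dc] := pselect (D c); first by have /andP[] := Gb m c sm Dc.
  by rewrite G0// lee_fin.
have E : (\int[usq2]_c ((cst 4%:E) \_ D) c = 2%:E)%E.
  rewrite -integral_mkcond integral_cst//.
  by rewrite [X in (_ * X)%E]measure_D -EFinM; congr EFin; field.
have := @dominated_convergence _ _ _ usq2 setT measurableT
  (fun k => G (k + s)%N) ((cst 4%:E) \_ D) (cst 4%:E).
rewrite E; case=> //.
- by apply/(measurable_restrictT _ _).1.
- apply: aeW => c _; have [Dc|Dc] := boolP (c \in D); last first.
    rewrite patchE (negbTE Dc); rewrite notin_setE in Dc.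
    rewrite [X in X @ _](_ : _ = cst 0%E); first exact: cvg_cst.
    by apply/funext => k; rewrite G0.
  rewrite patchT//.
  apply: (@squeeze_cvge _ _ _ _
    (fun k => (4 * (binomial_tail (k + s) s).[weight_margin c.1 c.2])%:E) _ (cst 4%:E)).
  + by apply: nearW => k; apply: Gb; [exact: leq_addl|exact: set_mem].
  + apply: cvg_EFin; first exact: nearW.
    rewrite /comp /= -[X in _ --> X]mulr1; apply: cvgM; first exact: cvg_cst.
    rewrite (cvg_shiftn s (fun m => (binomial_tail m s).[weight_margin c.1 c.2])).
    apply: binomial_tail_cvg; move/set_mem: Dc => /and3P[pS rS pr].
    exact: weight_margin01.
  + exact: cvg_cst.
- exact: finite_measure_integrable_cst.
- by apply: aeW => c k _; apply: G4; exact: leq_addl.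
Qed.
End limit.

(** * Independent families *)

Section independent_family.
Context {d d2} {T : measurableType d} {S : measurableType d2} {R : realType}.
Variables (P : probability T R) (mu : probability S R).
Variables (I : eqType) (Y : I -> T -> S).
Hypothesis mY : forall i, measurable_fun setT (Y i).
Implicit Types L : seq I.

(** For a list without repetition, one formula on rectangles says that [V] has law [nu], that the
    [Y l] have law [mu], and that all of them are independent. [V] is kept apart because it absorbs
    the [Y l] one by one. *)
Definition indep_family d1 (E : measurableType d1) (V : T -> E)
    (nu : probability E R) (L : seq I) :=
  forall A B, measurable A -> (forall l, measurable (B l)) ->
    (P (V @^-1` A `&` [set w | forall l, l \in L -> B l (Y l w)]) =
     nu A * \prod_(l <- L) mu (B l))%E.

Lemma measurable_rectangle_event L (B : I -> set S) :
  (forall l, measurable (B l)) ->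
  measurable [set w | forall l, l \in L -> B l (Y l w)].
Proof.
move=> mB; elim: L => [|l L IH].
  by rewrite (_ : mkset _ = setT) //; apply/seteqP; split.
rewrite (_ : mkset _ = (Y l @^-1` B l) `&` [set w | forall l, l \in L -> B l (Y l w)]).
  by apply: measurableI => //; rewrite -[X in measurable X]setTI; exact: mY.
apply/seteqP; split=> w /= => [H|[H1 H2] i].
  by split=> [|i iL]; apply: H; rewrite inE ?eqxx// iL orbT.
by rewrite inE => /orP[/eqP ->//|]; exact: H2.
Qed.

(** With the sets [B] fixed, both sides are finite measures in the set of pairs [C]. They agree on
    rectangles, where the hypothesis for [l :: L] applies, hence everywhere. *)
Lemma indep_family_cons d1 (E : measurableType d1) (V : T -> E)
    (nu : probability E R) l L : measurable_fun setT V -> l \notin L ->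
  indep_family V nu (l :: L) ->
  indep_family (fun w => (V w, Y l w)) (nu \x mu)%E L.
Proof.
move=> mV lL iV C B mC mB.
set F := [set w | _].
have mF : measurable F by exact: measurable_rectangle_event.
have mW : measurable_fun setT (fun w => (V w, Y l w)) by exact: measurable_fun_pair.
have c0 : (0 <= \prod_(i <- L) mu (B i))%E.
  by elim/big_rec : _ => // i x _ x0; rewrite mule_ge0.
have cfin : (\prod_(i <- L) mu (B i))%E \is a fin_num.
  by elim/big_rec : _ => // i x _ x0; rewrite fin_numM// fin_num_measure.
have [c cE] : exists c : {nonneg R}, (\prod_(i <- L) mu (B i) = c%:num%:E)%E.
  have c0' : (0 <= fine (\prod_(i <- L) mu (B i)))%R by rewrite fine_ge0.
  by exists (NngNum c0'); rewrite /= fineK.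
(* The constant is moved into the first factor, so that uniqueness of product measures applies to
   [nu' \x mu]. *)
pose nu' : {finite_measure set E -> \bar R} := mscale c nu.
have e1 : (nu' \x mu)%E C = mscale c (nu \x mu)%E C.
  apply: product_measure_unique mC => A D mA mD.
  transitivity (c%:num%:E * (nu \x mu) (A `*` D))%E => //.
  by rewrite product_measure1E// muleA.
have e2 : (nu' \x mu)%E C = pushforward (mrestr P mF) (fun w => (V w, Y l w)) C.
  apply: (@product_measure_unique _ _ _ _ _ nu' mu
    (pushforward (mrestr P mF) (fun w => (V w, Y l w)))) mC => A D mA mD.
  pose B' i := if i == l then D else B i.
  have B'l : B' l = D by rewrite /B' eqxx.
  have B'L i : i \in L -> B' i = B i.
    by move=> iL; rewrite /B' ifF//; apply/negP => /eqP il; rewrite -il iL in lL.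
  have mB' i : measurable (B' i) by rewrite /B'; case: ifP.
  have := iV A B' mA mB'; rewrite big_cons B'l.
  rewrite (eq_big_seq (fun i => mu (B i))) => [E1|i /B'L -> //].
  transitivity (c%:num%:E * nu A * mu D)%E; last by [].
  rewrite -cE -muleA muleC -muleA -E1.
  rewrite /pushforward /mrestr; congr (P _).
  apply/seteqP; split=> w /= [].
    move=> [Aw Dw] Fw; split=> // i; rewrite inE => /orP[/eqP ->|iL].
      by rewrite B'l.
    by rewrite B'L//; exact: Fw.
  move=> Aw H; split; first split=> //.
    by have := H l; rewrite inE eqxx B'l; apply.
  by move=> i iL; have := H i; rewrite inE iL orbT B'L//; exact.
rewrite cE muleC.
have -> : (c%:num%:E * (nu \x mu) C)%E = mscale c (nu \x mu)%E C by [].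
by rewrite -e1 e2.
Qed.

Lemma measurable_prod_xsection d1 (E : measurableType d1) (C : I -> set (E * S)) L :
  (forall l, measurable (C l)) ->
  measurable_fun [set: E] ((fun v => \prod_(l <- L) mu (xsection (C l) v))%E : E -> \bar R).
Proof.
move=> mC; elim: L => [|l L IH].
  by under eq_fun do rewrite big_nil; exact: measurable_cst.
under eq_fun do rewrite big_cons.
by apply: emeasurable_funM => //; exact: measurable_fun_xsection.
Qed.

(* Freezing: conditionally on [V], the [Y l] are still independent with law [mu]. *)
Lemma indep_family_section d1 (E : measurableType d1) (V : T -> E)
    (nu : probability E R) L (A : set E) (C : I -> set (E * S)) :
  measurable_fun setT V -> uniq L -> indep_family V nu L ->
  measurable A -> (forall l, measurable (C l)) ->
  (P (V @^-1` A `&` [set w | forall l, l \in L -> C l (V w, Y l w)]) =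
   \int[nu]_(v in A) \prod_(l <- L) mu (xsection (C l) v))%E.
Proof.
(* The induction is general in [V]: the next step freezes the pair of [V] and [Y l], and the
   condition [C l] becomes part of the set imposed on this pair. Tonelli then splits off the factor
   of [l]. *)
elim: L d1 E V nu A C => [|l L IH] d1 E V nu A C mV.
  move=> _ iV mA mC.
  have := iV A (fun=> setT) mA (fun=> measurableT); rewrite big_nil mule1.
  rewrite (_ : mkset _ = setT); last by apply/seteqP; split.
  rewrite (_ : mkset _ = setT); last by apply/seteqP; split.
  move=> ->; under eq_integral do rewrite big_nil.
  by rewrite integral_cst// mul1e.
rewrite cons_uniq => /andP[lL uL] iV mA mC.
pose C' i : set ((E * S) * S) := (fun z => (z.1.1, z.2)) @^-1` C i.
have mC' i : measurable (C' i).
  rewrite -[X in measurable X]setTI; apply: measurable_fun_pair => //.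
  exact: measurableT_comp.
have mW : measurable_fun setT (fun w => (V w, Y l w)) by exact: measurable_fun_pair.
have mA' : measurable ((A `*` setT) `&` C l).
  by apply: measurableI => //; exact: measurableX.
have := IH _ _ _ _ _ _ mW uL (indep_family_cons mV lL iV) mA' mC'.
rewrite (_ : _ `&` _ = V @^-1` A `&`
  [set w | forall l', l' \in l :: L -> C l' (V w, Y l' w)]); last first.
  apply/seteqP; split=> w /= [].
    move=> [[Aw _] Cw] H; split=> // i; rewrite inE => /orP[/eqP -> //|iL]; exact: H.
  move=> Aw H; split; first by split=> //; apply: H; rewrite mem_head.
  by move=> i iL; apply: H; rewrite inE iL orbT.
move=> ->.
have C'E i v : xsection (C' i) v = xsection (C i) v.1.
  by apply/seteqP; split=> y; rewrite /xsection /= !inE.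
under eq_integral do under eq_bigr do rewrite C'E.
rewrite integral_mkcond fubini_tonelli1/=; last 2 first.
- apply/(measurable_restrictT _ _).1 => //.
  apply: measurable_funTS.
  exact: (measurableT_comp (measurable_prod_xsection L mC)).
- move=> z; rewrite patchE; case: ifP => // _.
  by elim/big_rec : _ => // i x _ x0; rewrite mule_ge0.
rewrite [RHS]integral_mkcond; apply: eq_integral => v _.
rewrite /fubini_F !patchE; case: ifPn => vA.
  rewrite big_cons muleC -integral_cst; last exact: measurable_xsection.
  rewrite [RHS]integral_mkcond; apply: eq_integral => y _.
  rewrite !patchE; congr (if _ then _ else _).
  apply/idP/idP; rewrite /xsection inE /= => h.
    by rewrite inE /=; apply/mem_set; case: h.
  by rewrite inE /=; split; [split=> //; exact/set_mem|move: h; rewrite inE].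

rewrite integral0_eq// => y _; rewrite patchE ifF//.
by apply/negbTE; apply: contra vA; rewrite !inE /= => -[[]].
Qed.

End independent_family.

(** * Independent uniform points *)

Section integral_eq_off_null.
Import HBNNSimple.

(* [f] need not be measurable: in the application, [f] counts triangles of a point
   set in which some points may coincide, and its measurability is not needed. *)
Lemma ge0_integral_eq_off_null d (T : measurableType d) (R : realType)
    (mu : {measure set T -> \bar R}) (N : set T) (f g : T -> \bar R) :
  measurable N -> mu N = 0%E -> measurable_fun setT g ->
  (forall x, 0 <= f x)%E -> (forall x, 0 <= g x)%E ->
  (forall x, ~ N x -> f x = g x) ->
  (\int[mu]_x f x = \int[mu]_x g x)%E.
Proof.
move=> mN N0 mg f0 g0 fg.
apply/eqP; rewrite eq_le; apply/andP; split.
  (* The integral of [f] is a supremum over simple functions; each one below [f] is below [g] off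
     [N]. *)
  rewrite ge0_integralTE//; apply: ge_ereal_sup => _ /= [h hf <-].
  rewrite -integralT_nnsfun.
  have mh : measurable_fun setT (EFin \o h) by exact/measurable_EFinP.
  rewrite (ge0_negligible_integral mN measurableT mh _ N0); last by move=> x _; rewrite lee_fin.
  rewrite (ge0_negligible_integral mN measurableT mg _ N0)//.
  apply: ge0_le_integral => //; do ?[exact: measurableD|exact: measurable_funTS].
    by move=> x _; rewrite lee_fin.
  by move=> x [_ Nx] /=; rewrite -fg.
rewrite (ge0_negligible_integral mN measurableT mg _ N0)// setTD integral_mkcond.
rewrite !ge0_integralTE//; last by move=> x; rewrite patchE; case: ifP.
apply: le_ereal_sup => _ /= [h hg <-]; exists h => // x.
(* Conversely [g] set to 0 on [N] is below [f] everywhere, so the simple functions below it compete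
   for [f]. *)
apply: (le_trans (hg x)); rewrite patchE; case: ifPn => // Nx.
by rewrite fg//; exact/set_mem.
Qed.

End integral_eq_off_null.

Section law.
Context {R : realType} d (T : measurableType d) (P : probability T R).
Notation usq := (@uniform_square R).
Notation usq2 := (@uniform_square2 R).
Notation usq3 := (@uniform_square3 R).

Lemma uniform_on_squareE (X : {RV P >-> (R * R)%type}) : uniform_on_square X ->
  forall B, measurable B -> P (X @^-1` B) = usq B.
Proof.
move=> uX B mB; apply/esym.
apply: (@product_measure_unique _ _ _ _ _ uniform01 uniform01 (distribution P X)) mB.
move=> A C mA mC; transitivity (distribution P X (A `*` C)) => //.
rewrite uX; last exact: measurableX.
rewrite /unit_square -setXI; transitivity (@uniform01 R A * @uniform01 R C)%E => //.
rewrite !uniform01E//.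
by apply: product_measure1E; apply: measurableI => //; exact: measurable_itv.
Qed.

Variables (n : nat) (X : 'I_n -> {RV P >-> (R * R)%type}).
Hypothesis unifX : forall i, uniform_on_square (X i).
Hypothesis indepX : mutually_independent X.

Let mX i : measurable_fun setT (X i). Proof. by []. Qed.

Lemma indep_family1 i L : uniq (i :: L) -> indep_family P usq X (X i) usq L.
Proof.
rewrite cons_uniq => /andP[iL uL] A B mA mB.
pose B' j := if j == i then A else B j.
have B'i : B' i = A by rewrite /B' eqxx.
have B'L j : j \in L -> B' j = B j.
  by move=> jL; rewrite /B' ifF//; apply/eqP => ji; rewrite -ji jL in iL.
have mB' j : measurable (B' j) by rewrite /B'; case: ifP.
have := indepX (J := [set j in i :: L]%SET) (B := B') (fun j _ => mB' j).
rewrite (_ : \bigcap_(_ in _) _ = X i @^-1` A `&` [set w | forall l, l \in L -> B l (X l w)]).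
  move=> ->.
  rewrite (eq_bigl (mem (i :: L))) => [|j]; last by rewrite !inE.
  rewrite -big_uniq/=; last by rewrite iL uL.
  rewrite big_cons B'i (uniform_on_squareE (@unifX i) mA); congr (_ * _)%E.
  apply: eq_big_seq => j jL; rewrite -(B'L _ jL).
  exact: (uniform_on_squareE (@unifX j) (mB' j)).
apply/seteqP; split=> w /= => [H|[Aw H] j /=].
  split; first by rewrite -B'i; apply: H => /=; rewrite !inE eqxx.
  by move=> l lL; rewrite -B'L//; apply: H => /=; rewrite !inE lL orbT.
rewrite !inE => /orP[/eqP->|jL]; first by rewrite B'i.
by rewrite B'L//; exact: H.
Qed.

Lemma indep_family3 i k j L : uniq [:: i, k, j & L] ->
  indep_family P usq X (fun w => ((X i w, X k w), X j w)) usq3 L.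
Proof.
move=> u; have u1 := u; move: u1 => /= /and4P[_ kL jL uL].
apply: indep_family_cons => //; first exact: measurable_fun_pair.
apply: indep_family_cons => //.
exact: indep_family1.
Qed.

Lemma indep_family2 i k : i != k ->
  forall A, measurable A -> P [set w | A (X i w, X k w)] = usq2 A.
Proof.
move=> ik A mA.
have ik1 : uniq [:: i; k] by rewrite /= inE ik.
have iV := indep_family_cons mX (mX i) (erefl : k \notin [::]) (indep_family1 ik1).
have := iV A (fun=> setT) mA (fun=> measurableT).
rewrite big_nil mule1 => <-.
by congr (P _); apply/seteqP; split=> w //= [].
Qed.

Lemma uniform_square_tie : usq2 [set c : (R * R) * (R * R) | c.1.1 == c.2.1] = 0%E.
Proof.
transitivity (\int[usq]_p (usq (xsection [set c : (R * R) * (R * R) | c.1.1 == c.2.1] p)))%E => //.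
rewrite integral0_eq// => p _.
have -> : xsection [set c : (R * R) * (R * R) | c.1.1 == c.2.1] p = [set p.1] `*` setT.
  apply/seteqP; split=> z; rewrite /xsection /= inE /=; first by move=> /eqP->.
  by case=> ->.
rewrite uniform_squareX//; have -> : uniform01 [set p.1] = 0%E; last by rewrite mul0e.
rewrite uniform01E//; apply: (@subset_measure0 _ _ _ lebesgue_measure _ [set p.1]) => //.
- by apply: measurableI; [exact: measurable_set1|exact: measurable_itv].
- exact: lebesgue_measure_set1.
Qed.

Lemma uniform_square_boundary : usq [set z | ~~ in_open_square z] = 0%E.
Proof.
have -> : [set z | ~~ in_open_square z] = ~` (`]0%R, 1%R[ `*` `]0%R, 1%R[ : set (R * R)).
  apply/seteqP; split=> z; rewrite /= !in_itv/= /in_open_square.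
    by move=> /negP h h2; apply: h; apply/andP.
  by move=> h; apply/negP => /andP.
rewrite probability_setC; last exact: measurableX.
by rewrite uniform_squareX// uniform01_oo// subr0 mule1 subee.
Qed.

(** A finite union of null events: a point off the open square, or a pair of indices with equal
    abscissae. Off it, [Z_eq] equals a measurable count. *)
Lemma general_position_off_null : exists N : set T, [/\ measurable N, P N = 0%E &
  forall w, ~ N w -> (forall i, in_open_square (X i w)) /\ injective (fun i => (X i w).1)].
Proof.
have m1 i : measurable [set w | ~~ in_open_square (X i w)].
  rewrite -[X in measurable X]setTI.
  have /(_ measurableT [set true]) : measurable_fun setT (fun w => ~~ in_open_square (X i w)).
    by apply: measurable_neg; exact: measurable_in_open_square.
  exact.
have m2 i k : measurable [set w | (X i w).1 == (X k w).1].
  rewrite -[X in measurable X]setTI.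
  have /(_ measurableT [set true]) : measurable_fun setT (fun w => (X i w).1 == (X k w).1).
    by apply: measurable_fun_eqr; exact: (measurableT_comp measurable_fst).
  exact.
pose N1 i := [set w | ~~ in_open_square (X i w)].
pose N2 (c : 'I_n * 'I_n) := [set w | (X c.1 w).1 == (X c.2 w).1].
have [mN1 N10] : measurable (\big[setU/set0]_i N1 i) /\ P (\big[setU/set0]_i N1 i) = 0%E.
  apply: (big_ind (fun N => measurable N /\ P N = 0%E)) => [|A B [mA A0] [mB B0]|i _].
  - by split=> //; exact: measure0.
  - by split; [exact: measurableU|exact: null_set_setU].
  - split; first exact: m1.
    rewrite -[RHS]uniform_square_boundary -(uniform_on_squareE (@unifX i))//.
    have /(_ measurableT [set true]) :=
      measurable_neg (measurable_in_open_square (@measurable_id _ (R * R)%type setT)).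
    by rewrite setTI; exact.
have [mN2 N20] : measurable (\big[setU/set0]_(c | c.1 != c.2) N2 c) /\
    P (\big[setU/set0]_(c | c.1 != c.2) N2 c) = 0%E.
  apply: (big_ind (fun N => measurable N /\ P N = 0%E)) => [|A B [mA A0] [mB B0]|c c12].
  - by split=> //; exact: measure0.
  - by split; [exact: measurableU|exact: null_set_setU].
  - split; first exact: m2.
    rewrite -[RHS]uniform_square_tie -(indep_family2 c12)//.
    rewrite -[X in measurable X]setTI.
    have /(_ measurableT [set true]) : measurable_fun setT
        (fun c : (R * R) * (R * R) => c.1.1 == c.2.1).
      by apply: measurable_fun_eqr; [exact: (measurableT_comp measurable_fst measurable_fst)|
        exact: (measurableT_comp measurable_fst measurable_snd)].
    exact.
exists (\big[setU/set0]_i N1 i `|` \big[setU/set0]_(c | c.1 != c.2) N2 c); split.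
- exact: measurableU.
- exact: null_set_setU.
- move=> w Nw; split=> [i|i k e].
    apply/negP => /negP h; by apply: Nw; left; rewrite (bigD1 i)//=; left.
  apply/eqP/negPn/negP => ik; apply: Nw; right.
  by rewrite (bigD1 (i, k))//=; left; apply/eqP.
Qed.

End law.

(** * Expected number of triangles *)

Lemma measurable_sum_cond d (T : measurableType d) (R : realType) (I : finType)
    (Q : pred I) (h : I -> T -> R) : (forall i, measurable_fun setT (h i)) ->
  measurable_fun setT (fun w => \sum_(i | Q i) h i w).
Proof.
move=> mh; under eq_fun do rewrite -big_filter.
exact: measurable_sum.
Qed.

Lemma ge0_integral_sum_cond d (T : measurableType d) (R : realType)
    (mu : {measure set T -> \bar R}) (I : finType) (Q : pred I) (h : I -> T -> R) :
  (forall i, measurable_fun setT (h i)) -> (forall i w, 0 <= h i w) ->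
  (\int[mu]_w (\sum_(i | Q i) h i w)%:E = \sum_(i | Q i) \int[mu]_w (h i w)%:E)%E.
Proof.
move=> mh h0.
under eq_integral do rewrite -sumEFin -big_filter.
rewrite ge0_integral_sum ?big_filter// => [i|i w _]; last by rewrite lee_fin.
exact/measurable_EFinP.
Qed.

Lemma sume_const (R : realType) (I : finType) (Q : pred I) (x : \bar R) :
  (\sum_(i | Q i) x = #|Q|%:R%:E * x)%E.
Proof.
rewrite big_const; elim: #|_| => [|k IH]; first by rewrite mul0e.
by rewrite iterS IH mulrS EFinD ge0_muleDl ?lee_fin// mul1e.
Qed.

Section expectation.
Context {R : realType} d (T : measurableType d) (P : probability T R).
Notation usq := (@uniform_square R).
Notation usq3 := (@uniform_square3 R).
Variables (n : nat) (X : 'I_n -> {RV P >-> (R * R)%type}).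
Hypothesis unifX : forall i, uniform_on_square (X i).
Hypothesis indepX : mutually_independent X.

Let mX i : measurable_fun setT (X i). Proof. by []. Qed.

Let V (t : 'I_n * 'I_n * 'I_n) (w : T) := ((X t.1.1 w, X t.1.2 w), X t.2 w).

Let generic : set ((R * R) * (R * R) * (R * R)) :=
  [set v | generic_triangle v.1.1 v.2 v.1.2].

Let m1 : measurable_fun setT (fun v : (R * R) * (R * R) * (R * R) => v.1.1).
Proof. exact: (measurableT_comp measurable_fst measurable_fst). Qed.
Let m2 : measurable_fun setT (fun v : (R * R) * (R * R) * (R * R) => v.1.2).
Proof. exact: (measurableT_comp measurable_snd measurable_fst). Qed.

Let mgeneric : measurable generic.
Proof.
rewrite -[generic]setTI.
have /(_ measurableT [set true]) := measurable_generic_triangle m1 measurable_snd m2.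
exact.
Qed.

Let inside_pattern (S : {set 'I_n}) l : set ((R * R) * (R * R) * (R * R) * (R * R)) :=
  [set z | inside z.1.1.1 z.1.2 z.1.1.2 z.2 = (l \in S)].

Let ins : set ((R * R) * (R * R) * (R * R) * (R * R)) :=
  [set z | inside z.1.1.1 z.1.2 z.1.1.2 z.2].

Let inside_patternE S l : inside_pattern S l = if l \in S then ins else ~` ins.
Proof.
rewrite /inside_pattern /ins; case: (l \in S); apply/seteqP; split=> z //=.
  by move=> ->.
by move=> /negP/negbTE.
Qed.

Let mins : measurable ins.
Proof.
apply: measurable_inside.
- exact: (measurableT_comp m1 measurable_fst).
- exact: (measurableT_comp measurable_snd measurable_fst).
- exact: (measurableT_comp m2 measurable_fst).
- exact: measurable_snd.
Qed.

(** Prescribing the exact set [S] of interior indices, and not only its size, makes the event a list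
    of separate conditions on the remaining points, to which freezing applies. *)
Definition triangle_event t (S : {set 'I_n}) : set T :=
  V t @^-1` generic `&`
  [set w | forall l, l \in enum (~: [set t.1.1; t.1.2; t.2])%SET ->
     inside_pattern S l (V t w, X l w)].

Let tarea (v : (R * R) * (R * R) * (R * R)) : R := `|cross v.1.1 v.2 v.1.2| / 2.

Definition triangle_prob m s : \bar R :=
  (\int[usq3]_(v in generic) (tarea v ^+ s * (1 - tarea v) ^+ (m - s))%:E)%E.

Lemma prodEFin_count (L : seq 'I_n) (S : {set 'I_n}) (a b : R) :
  (\prod_(l <- L) (if l \in S then a%:E else b%:E) =
   (a ^+ count (mem S) L * b ^+ count (predC (mem S)) L)%:E)%E.
Proof.
elim: L => [|l L IH]; first by rewrite big_nil /= mulr1.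
have c1 : count (mem S) (l :: L) = ((l \in S) + count (mem S) L)%N by [].
have c2 : count (predC (mem S)) (l :: L) = (~~ (l \in S) + count (predC (mem S)) L)%N by [].
rewrite big_cons IH c1 c2; case: (l \in S); rewrite -EFinM; congr EFin.
  by rewrite /= add1n add0n exprS mulrA.
by rewrite /= add1n add0n exprS mulrCA.
Qed.

(** Once the vertices are frozen, each of the [n - 3] other indices contributes the area if it
    belongs to [S], and the complement of the area otherwise. *)
Lemma prob_triangle_event t (S : {set 'I_n}) : uniq [:: t.1.1; t.1.2; t.2] ->
  S \subset (~: [set t.1.1; t.1.2; t.2])%SET ->
  P (triangle_event t S) = triangle_prob (n - 3) #|S|.
Proof.
set A := [set _; _; _]%SET => ut SA.
have uL : uniq [:: t.1.1, t.1.2, t.2 & enum (~: A)%SET].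
  move: ut => /= /and3P[h1 h2 _].
  rewrite !inE !mem_enum !inE !eqxx !orbT /= enum_uniq !andbT orbF.
  by move: h1 h2; rewrite !inE ?orbF => -> ->.
have iV := indep_family3 unifX indepX uL.
have mV : measurable_fun setT (V t).
  by apply: measurable_fun_pair => //; apply: measurable_fun_pair.
have mC l : measurable (inside_pattern S l).
  by rewrite inside_patternE; case: ifP => // _; exact: measurableC.
rewrite /triangle_event (indep_family_section mX mV (enum_uniq _) iV mgeneric mC).
apply: eq_integral => v /set_mem /and4P[pS qS rS /and3P[pq qr _]].
have area : usq (xsection ins v) = (tarea v)%:E.
  rewrite (_ : xsection ins v = [set z | inside v.1.1 v.2 v.1.2 z]); last first.
    by apply/seteqP; split=> z; rewrite /xsection /= inE.
  move: pS qS rS => /andP[/andP[/ltW p0 _] /andP[/ltW ? /ltW ?]].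
  move=> /andP[_ /andP[/ltW ? /ltW ?]] /andP[/andP[_ /ltW r1] /andP[/ltW ? /ltW ?]].
  by apply: uniform_square_inside => //; apply/andP.
transitivity (\prod_(l <- enum (~: A)%SET) (if l \in S then (tarea v)%:E else (1 - tarea v)%:E))%E.
  apply: eq_bigr => l _; rewrite inside_patternE; case: ifP => // _.
  rewrite (_ : xsection (~` ins) v = ~` xsection ins v); last first.
    by apply/seteqP; split=> y /=; rewrite /xsection /= in_setC => /negP.
  rewrite [LHS]probability_setC; last exact: measurable_xsection.
  by rewrite [X in (_ - X)%E]area.
rewrite prodEFin_count.
have cS : count (mem S) (enum (~: A)%SET) = #|S|.
  rewrite -size_filter cardE; apply/perm_size/uniq_perm;
    [exact/filter_uniq/enum_uniq|exact: enum_uniq|].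
  move=> l; rewrite mem_filter !mem_enum; apply/andP/idP => [[]//|lS].
  by split=> //; exact: (fintype.subsetP SA).
have cA : #|A| = 3%N.
  move: ut => /= /and3P[]; rewrite !inE negb_or => /andP[h1 h2] h3 _.
  by rewrite /A finset.setUC cardsU1 cards2 !inE h1 negb_or ![t.2 == _]eq_sym h2 h3.
have := count_predC (mem S) (enum (~: A)%SET).
rewrite cS -cardE (cardsCs (~: A)%SET) finset.setCK cA card_ord.
by move=> <-; rewrite addKn.
Qed.

Lemma triangle_prob_weight m s :
  ((m.+1 * 'C(m, s))%:R%:E * triangle_prob m s =
   \int[usq3]_v (triangle_weight m s v)%:E)%E.
Proof.
have mt : measurable_fun setT tarea.
  apply: measurable_funM => //; apply: measurableT_comp => //.
  exact: (measurable_cross m1 measurable_snd m2).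
rewrite -ge0_integralZl//; last 2 first.
- apply/measurable_EFinP/measurable_funTS; apply: measurable_funM; apply: measurable_funX => //.
  exact: measurable_funB.
- move=> v /and4P[pS qS rS _]; rewrite lee_fin mulr_ge0// exprn_ge0//.
    by rewrite divr_ge0.
  by rewrite subr_ge0 ler_pdivrMr// mul1r cross_le1.
rewrite integral_mkcond; apply: eq_integral => v _; rewrite patchE /triangle_weight.
have -> : (v \in generic) = generic_triangle v.1.1 v.2 v.1.2.
  by apply/idP/idP => [/set_mem//|h]; exact/mem_set.
by case: ifP => _; rewrite -?EFinM.
Qed.

Lemma measurable_triangle_event t S : measurable (triangle_event t S).
Proof.
have mV : measurable_fun setT (V t).
  by apply: measurable_fun_pair => //; apply: measurable_fun_pair.
apply: measurableI; first by rewrite -[X in measurable X]setTI; exact: mV.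
rewrite (_ : mkset _ = \bigcap_(l in [set l | l \in enum (~: [set t.1.1; t.1.2; t.2])%SET])
  ((fun w => (V t w, X l w)) @^-1` inside_pattern S l)); last first.
  by apply/seteqP; split=> w.
apply: fin_bigcap_measurable => // l _.
rewrite -[X in measurable X]setTI; apply: measurable_fun_pair => //.
by rewrite inside_patternE; case: ifP => // _; exact: measurableC.
Qed.

Definition triangle_count s (w : T) : R :=
  \sum_(t : 'I_n * 'I_n * 'I_n | uniq [:: t.1.1; t.1.2; t.2])
    \sum_(S : {set 'I_n} | (S \subset ~: [set t.1.1; t.1.2; t.2])%SET && (#|S| == s))
      \1_(triangle_event t S) w.

(** For a triple in increasing order, the only event realized is that of the actual set [I0] of
    interior indices, which enters the sum exactly when it has [s] elements; for any other triple,
    no event is. *)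
Lemma Z_eq_triangle_count s w :
  (forall i, in_open_square (X i w)) -> injective (fun i => (X i w).1) ->
  (Z_eq s (point_set X w))%:R = triangle_count s w.
Proof.
move=> inS inj1; rewrite /point_set Z_eq_triangle_index//.
rewrite -sum1_card natr_sum big_mkcond /triangle_count [RHS]big_mkcond.
apply: eq_bigr => t _; set A := [set _; _; _]%SET.
set I0 := [set l | inside (X t.1.1 w) (X t.2 w) (X t.1.2 w) (X l w)]%SET.
have evE (S : {set 'I_n}) : S \subset (~: A)%SET ->
    \1_(triangle_event t S) w =
    (triangle_lr (X t.1.1 w) (X t.2 w) (X t.1.2 w) && (S == I0))%:R :> R.
  move=> SA; rewrite indicE; congr (nat_of_bool _)%:R.
  apply/idP/andP => [/set_mem [/and4P[_ _ _ lr] H]|[lr /eqP SI]].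
    split=> //; apply/eqP/setP => l; rewrite inE.
    have [lA|lA] := boolP (l \in A).
      rewrite [RHS]inside_notin; last first.
        by move: lA; rewrite !inE => /orP[/orP[]|] /eqP ->; rewrite eqxx ?orbT.
      by apply/negbTE; apply: contraL lA => /(fintype.subsetP SA); rewrite inE.
    by apply/esym; apply: H; rewrite mem_enum inE.
  apply/mem_set; split; first by rewrite /generic /V /= /generic_triangle !inS.
  by move=> l lA; rewrite /inside_pattern /= SI inE.
have I0A : triangle_lr (X t.1.1 w) (X t.2 w) (X t.1.2 w) -> I0 \subset (~: A)%SET.
  move=> lr; apply/fintype.subsetP => l; rewrite !inE; apply: contraL => lA.
  rewrite inside_notin//.
  by move: lA => /orP[/orP[]|] /eqP ->; rewrite !inE eqxx ?orbT.
have ut : triangle_lr (X t.1.1 w) (X t.2 w) (X t.1.2 w) -> uniq [:: t.1.1; t.1.2; t.2].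
  move=> /and3P[pq qr _].
  have ne i k : (X i w).1 < (X k w).1 -> i != k.
    by move=> h; apply/eqP => ik; rewrite ik ltxx in h.
  rewrite /= !inE negb_or (ne _ _ pq) (ne _ _ (lt_trans pq qr)).
  by rewrite eq_sym (ne _ _ qr).
rewrite [t \in _]inE -/I0.
case: (boolP (triangle_lr _ _ _)) => [lr|lr]; last first.
  rewrite andFb; case: ifP => // _; rewrite big1// => S /andP[SA _].
  by rewrite evE// (negbTE lr).
rewrite andTb (ut lr).
have [sI|sI] := boolP (#|I0| == s).
  rewrite (bigD1 I0)/=; last by rewrite I0A.
  rewrite evE ?I0A// lr eqxx big1 ?addr0// => S /andP[/andP[SA _] SI].
  by rewrite evE// (negbTE SI) andbF.
rewrite big1// => S /andP[SA sS]; rewrite evE// lr; case: eqP => // SI.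
by rewrite SI (negbTE sI) in sS.
Qed.

Lemma measurable_triangle_count s : measurable_fun setT (triangle_count s).
Proof.
apply: measurable_sum_cond => t; apply: measurable_sum_cond => S.
exact/measurable_indic/measurable_triangle_event.
Qed.

Lemma triangle_count_ge0 s w : 0 <= triangle_count s w.
Proof. by apply: sumr_ge0 => t _; apply: sumr_ge0. Qed.

Lemma card_distinct_triples :
  (\sum_(t : 'I_n * 'I_n * 'I_n | uniq [:: t.1.1; t.1.2; t.2]) 1 = n * (n - 1) * (n - 2))%N.
Proof.
rewrite (eq_bigl (fun t : 'I_n * 'I_n * 'I_n =>
  (t.1.1 != t.1.2) && (t.2 \notin [set t.1.1; t.1.2]%SET))); last first.
  move=> t; rewrite /= !inE !negb_or andbT ![t.2 == _]eq_sym.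
  by case: (t.1.1 == t.1.2).
rewrite -(pair_big_dep (fun c : 'I_n * 'I_n => c.1 != c.2)
  (fun c j => j \notin [set c.1; c.2]%SET) (fun _ _ => 1%N)).
rewrite (eq_bigr (fun=> (n - 2)%N)) => [|c c12]; last first.
  rewrite sum1_card -[n in RHS]card_ord -(cardsC [set c.1; c.2]%SET) cards2 c12 addKn.
  by apply: eq_card => j; rewrite [in LHS]unfold_in !inE.
rewrite -(pair_big_dep predT (fun i k : 'I_n => i != k) (fun _ _ => (n - 2)%N)).
rewrite (eq_bigr (fun=> ((n - 1) * (n - 2))%N)) => [|i _]; last first.
  rewrite sum_nat_const (eq_card (B := predC1 i)) => [|k]; last by rewrite !inE eq_sym.
  by rewrite cardC1 card_ord subn1.
by rewrite sum_nat_const card_ord mulnA.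
Qed.

Lemma integral_triangle_count s :
  (\int[P]_w (triangle_count s w)%:E =
   (n * (n - 1) * (n - 2) * 'C(n - 3, s))%:R%:E * triangle_prob (n - 3) s)%E.
Proof.
rewrite ge0_integral_sum_cond; last 2 first.
- move=> t; apply: measurable_sum_cond => S.
  exact/measurable_indic/measurable_triangle_event.
- by move=> t w; apply: sumr_ge0.
have tE t : uniq [:: t.1.1; t.1.2; t.2] ->
    (\int[P]_w (\sum_(S : {set 'I_n} | (S \subset ~: [set t.1.1; t.1.2; t.2])%SET &&
      (#|S| == s)) \1_(triangle_event t S) w)%:E =
     'C(n - 3, s)%:R%:E * triangle_prob (n - 3) s)%E.
  move=> ut; rewrite ge0_integral_sum_cond//; last first.
    by move=> S; exact/measurable_indic/measurable_triangle_event.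
  rewrite (eq_bigr (fun=> triangle_prob (n - 3) s)) => [|S /andP[SA /eqP <-]]; last first.
    rewrite integral_indic//; last exact: measurable_triangle_event.
    by rewrite setIT; exact: prob_triangle_event.
  rewrite sume_const; congr (_%:R%:E * _)%E.
  transitivity #|[set S : {set 'I_n} | (S \subset ~: [set t.1.1; t.1.2; t.2])%SET &
      #|S| == s]%SET|; first by rewrite cardsE.
  rewrite cards_draws; congr ('C(_, s)).
  move: ut => /= /and3P[]; rewrite !inE negb_or => /andP[h1 h2] h3 _.
  rewrite (cardsCs (~: _)%SET) finset.setCK card_ord; congr (_ - _)%N.
  by rewrite finset.setUC cardsU1 cards2 !inE h1 negb_or ![t.2 == _]eq_sym h2 h3.
rewrite (eq_bigr _ tE) sume_const muleA -EFinM -natrM; congr (_%:R%:E * _)%E.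
by rewrite -card_distinct_triples sum1_card.
Qed.

Lemma expectation_Z_eq s :
  ('E_P[fun w => (Z_eq s (point_set X w))%:R] =
   (n * (n - 1) * (n - 2) * 'C(n - 3, s))%:R%:E * triangle_prob (n - 3) s)%E.
Proof.
rewrite -integral_triangle_count unlock.
have [N [mN N0 good]] := general_position_off_null unifX indepX.
apply: (ge0_integral_eq_off_null mN N0).
- exact/measurable_EFinP/measurable_triangle_count.
- by move=> w; rewrite lee_fin.
- by move=> w; rewrite lee_fin triangle_count_ge0.
- by move=> w /good[inS inj1]; rewrite Z_eq_triangle_count.
Qed.

(** Linearity is applied to the measurable counts, which agree with all the [Z_eq r] off a single
    null set. *)
Lemma expectation_Z_le s :
  ('E_P[fun w => (Z_le s (point_set X w))%:R] =
   \sum_(r < s.+1) 'E_P[fun w => (Z_eq r (point_set X w))%:R])%E.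
Proof.
transitivity (\int[P]_w (\sum_(r < s.+1) triangle_count r w)%:E)%E.
  rewrite unlock.
  have [N [mN N0 good]] := general_position_off_null unifX indepX.
  apply: (ge0_integral_eq_off_null mN N0).
  - apply/measurable_EFinP/measurable_sum => r; exact: measurable_triangle_count.
  - by move=> w; rewrite lee_fin.
  - by move=> w; rewrite lee_fin sumr_ge0// => r _; exact: triangle_count_ge0.
  - move=> w /good[inS inj1]; rewrite /Z_le natr_sum; congr EFin.
    by apply: eq_bigr => r _; rewrite Z_eq_triangle_count.
rewrite ge0_integral_sum_cond; first last.
- by move=> r w; exact: triangle_count_ge0.
- by move=> r; exact: measurable_triangle_count.
by apply: eq_bigr => r _; rewrite expectation_Z_eq integral_triangle_count.
Qed.
End expectation.

Lemma expectation_Z_eq_cvg (R : realType) (d : nat -> measure_display)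
    (T : forall n : nat, measurableType (d n))
    (P : forall n : nat, probability (T n) R)
    (U : forall n : nat, 'I_n -> {RV (P n) >-> (R * R)%type})
    (Uunif : forall (n : nat) (i : 'I_n), uniform_on_square (U n i))
    (Uindep : forall n : nat, mutually_independent (U n))
    (s : nat) :
  (fun n : nat =>
     ('E_(P n)[fun w => (Z_eq s (point_set (U n) w))%:R] /
      (n%:R ^+ 2)%:E)%E) @ \oo --> 2%:E.
Proof.
pose W k := (\int[@uniform_square3 R]_v (triangle_weight (k + s) s v)%:E)%E.
(* With [n = k + (s + 3)], so that [n - 3 = k + s], this is [n (n - 1) / n^2 = 1 - 1 / n];
   [harmonic] at [i] is the inverse of [i + 1]. *)
pose c k : R := 1 - harmonic (k + (s + 2)).
rewrite -(cvg_shiftn (s + 3)).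
have WE k : (fun n : nat =>
     ('E_(P n)[fun w => (Z_eq s (point_set (U n) w))%:R] /
      (n%:R ^+ 2)%:E)%E) (k + (s + 3))%N = ((c k)%:E * W k)%E.
  rewrite /= expectation_Z_eq//; set n := (k + (s + 3))%N.
  have n3 : (n - 3)%N = (k + s)%N by rewrite /n; lia.
  have n2 : (n - 2)%N = (k + s).+1 by rewrite /n; lia.
  rewrite n3 n2 /W -triangle_prob_weight -mulnA natrM EFinM.
  rewrite -[X in (X / _)%E]muleA muleAC.
  rewrite inver ifF; last by rewrite expf_eq0/= pnatr_eq0 /n; lia.
  rewrite -EFinM; congr (_%:E * _)%E.
  rewrite /c.
  have -> : (n * (n - 1))%:R = n%:R * (n%:R - 1) :> R.
    by rewrite natrM natrB//; rewrite /n; lia.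
  have -> : harmonic (k + (s + 2)) = n%:R^-1 :> R.
    by rewrite /harmonic /=; congr (_%:R^-1); rewrite /n; lia.
  field; rewrite pnatr_eq0 /n; lia.
rewrite [X in X @ _](_ : _ = (fun k => (c k)%:E * W k)%E); last by apply/funext.
have : (fun k => (c k)%:E * W k)%E @ \oo --> (1 * 2%:E)%E.
  apply: cvgeM; first by [].
    apply: cvg_EFin; first exact: nearW.
    rewrite /comp /= /c -[X in _ --> X]subr0; apply: cvgB; first exact: cvg_cst.
    rewrite (cvg_shiftn (s + 2) (@harmonic R)).
    exact: cvg_harmonic.
  exact: triangle_weight_cvg.
by rewrite mul1e.
Qed.

Theorem theorem3 (R : realType) (d : nat -> measure_display)
    (T : forall n : nat, measurableType (d n))
    (P : forall n : nat, probability (T n) R)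
    (U : forall n : nat, 'I_n -> {RV (P n) >-> (R * R)%type})
    (Uunif : forall (n : nat) (i : 'I_n), uniform_on_square (U n i))
    (Uindep : forall n : nat, mutually_independent (U n))
    (s : nat) :
  (fun n : nat =>
     ('E_(P n)[fun w => (Z_eq s (point_set (U n) w))%:R] /
      (n%:R ^+ 2)%:E)%E) @ \oo --> 2%:E /\
  (fun n : nat =>
     ('E_(P n)[fun w => (Z_le s (point_set (U n) w))%:R] /
      (n%:R ^+ 2)%:E)%E) @ \oo --> (2 * (s.+1)%:R)%:E.
Proof.
split; first exact: expectation_Z_eq_cvg.
(* Nonnegativity lets the division by [n^2] distribute over a sum of extended reals, and limits pass
   through that sum. *)
have E0 r n : (0 <= 'E_(P n)[fun w => (Z_eq r (point_set (U n) w))%:R])%E.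
  by rewrite unlock; apply: integral_ge0 => w _; rewrite lee_fin.
have sumE n : ('E_(P n)[fun w => (Z_le s (point_set (U n) w))%:R] / (n%:R ^+ 2)%:E =
    \sum_(r < s.+1) ('E_(P n)[fun w => (Z_eq r (point_set (U n) w))%:R] / (n%:R ^+ 2)%:E))%E.
  by rewrite expectation_Z_le// ge0_sume_distrl.
rewrite [X in X @ _](_ : _ = (fun n => \sum_(r < s.+1)
   ('E_(P n)[fun w => (Z_eq r (point_set (U n) w))%:R] / (n%:R ^+ 2)%:E))%E); last by apply/funext.
have -> : (2 * s.+1%:R)%:E = (\sum_(r < s.+1) 2%:E)%E :> \bar R.
  by rewrite sume_const card_ord muleC EFinM.
apply: cvg_nnesum => r _; last exact: expectation_Z_eq_cvg.
apply: nearW => n; apply: mule_ge0 => //.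
by rewrite inve_ge0 lee_fin exprn_ge0.
Qed.
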